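(* Let $\Lambda$ be an $\Omega_{\mathcal{G}}$-algebra. Let $\mathcal{Q}$ be the linear quiver $v_1\to\cdots\to v_n$ with $n\ge1$ vertices. Then the path algebra $\Lambda\mathcal{Q}$ (that is, $T_n(\Lambda)$) is CM-finite.
   Context: Modules are finitely generated right modules. For an Artin algebra $\Lambda$, a module is Gorenstein projective if it is isomorphic to a syzygy of an acyclic complex $P^\bullet$ of finitely generated projectives such that $\mathrm{Hom}_\Lambda(P^\bullet,\Lambda)$ is also acyclic. $\mathrm{Gprj}\text{-}\Lambda$ is the full subcategory of these modules and $\underline{\mathrm{Gprj}}\text{-}\Lambda$ its stable category (morphisms modulo those factoring through projectives). $\mathrm{mod}\text{-}\mathcal{X}$ denotes finitely presented contravariant additive functors $\mathcal{X}\to\mathrm{Ab}$. An Artin algebra $\Lambda$, with $\mathrm{Gprj}\text{-}\Lambda$ contravariantly finite in $\mathrm{mod}\text{-}\Lambda$, is an $\Omega_{\mathcal{G}}$-algebra if $\mathrm{mod}\text{-}(\underline{\mathrm{Gprj}}\text{-}\Lambda)$ is a semisimple abelian category (all objects projective). An Artin algebra is CM-finite if it has finitely many indecomposable finitely generated Gorenstein projective modules up to isomorphism. $T_n(\Lambda)$ is the ring of lower triangular $n\times n$ matrices over $\Lambda$. For $\Lambda$ a finite dimensional algebra over a field $k$, the path algebra of $\mathcal{Q}$ over $\Lambda$ is $\Lambda\mathcal{Q}=k\mathcal{Q}\otimes_k\Lambda$, which for the linear quiver is $T_n(\Lambda)$. *)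

(* Defs.v *)
From HB Require Import structures.
From mathcomp Require Import all_boot all_algebra.
From mathcomp Require Import boolp.

Set Implicit Arguments.
Unset Strict Implicit.
Unset Printing Implicit Defensive.

Import GRing.Theory.
Local Open Scope ring_scope.
Local Open Scope quotient_scope.

Record category := Category {
  cat_obj :> Type;
  cat_hom : cat_obj -> cat_obj -> Type;
  cat_id : forall A, cat_hom A A;
  cat_comp : forall A B C, cat_hom B C -> cat_hom A B -> cat_hom A C;
  cat_compA : forall A B C D (h : cat_hom C D) (g : cat_hom B C)
    (f : cat_hom A B), cat_comp h (cat_comp g f) = cat_comp (cat_comp h g) f;
  cat_comp1f : forall A B (f : cat_hom A B), cat_comp (cat_id B) f = f;
  cat_compf1 : forall A B (f : cat_hom A B), cat_comp f (cat_id A) = f }.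

Notation "g \oc f" := (cat_comp g f) (at level 50, left associativity).

Section Abelian.
Variable C : category.
Implicit Types A B : C.

Definition monic A B (f : cat_hom A B) :=
  forall X (u v : cat_hom X A), f \oc u = f \oc v -> u = v.

Definition epic A B (f : cat_hom A B) :=
  forall X (u v : cat_hom B X), u \oc f = v \oc f -> u = v.

Definition zero_obj (Z : C) :=
  forall A, (exists! f : cat_hom A Z, True) /\ (exists! f : cat_hom Z A, True).

Definition zero_mor A B (f : cat_hom A B) :=
  exists Z : C, zero_obj Z /\
    exists (h : cat_hom Z B) (g : cat_hom A Z), f = h \oc g.

Definition is_product A B (P : C) (p : cat_hom P A) (q : cat_hom P B) :=
  forall X (u : cat_hom X A) (v : cat_hom X B),
    exists! w : cat_hom X P, p \oc w = u /\ q \oc w = v.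

Definition is_coproduct A B (S : C) (i : cat_hom A S) (j : cat_hom B S) :=
  forall X (u : cat_hom A X) (v : cat_hom B X),
    exists! w : cat_hom S X, w \oc i = u /\ w \oc j = v.

Definition is_kernel A B (f : cat_hom A B) K (k : cat_hom K A) :=
  zero_mor (f \oc k) /\
  forall X (u : cat_hom X A), zero_mor (f \oc u) ->
    exists! w : cat_hom X K, k \oc w = u.

Definition is_cokernel A B (f : cat_hom A B) Q (q : cat_hom B Q) :=
  zero_mor (q \oc f) /\
  forall X (u : cat_hom B X), zero_mor (u \oc f) ->
    exists! w : cat_hom Q X, w \oc q = u.

(* Freyd's definition; the additive structure on the Hom sets is a
   consequence of these conditions. *)
Definition abelian_category : Prop :=
  [/\ exists Z : C, zero_obj Z,
      (forall A B, exists P (p : cat_hom P A) (q : cat_hom P B),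
          is_product p q) /\
      (forall A B, exists S (i : cat_hom A S) (j : cat_hom B S),
          is_coproduct i j),
      (forall A B (f : cat_hom A B),
          exists K (k : cat_hom K A), is_kernel f k) /\
      (forall A B (f : cat_hom A B),
          exists Q (q : cat_hom B Q), is_cokernel f q),
      (forall A B (f : cat_hom A B), monic f ->
          exists D (g : cat_hom B D), is_kernel g f) &
      (forall A B (f : cat_hom A B), epic f ->
          exists D (g : cat_hom D A), is_cokernel g f)].

Definition projective_obj (P : C) :=
  forall A B (e : cat_hom A B), epic e ->
    forall f : cat_hom P B, exists g : cat_hom P A, e \oc g = f.

Definition semisimple_abelian : Prop :=
  abelian_category /\ forall P : C, projective_obj P.

End Abelian.

Record preadditive := Preadditive {
  pre_obj :> Type;
  pre_hom : pre_obj -> pre_obj -> zmodType;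
  pre_id : forall A, pre_hom A A;
  pre_comp : forall A B C, pre_hom B C -> pre_hom A B -> pre_hom A C;
  pre_compA : forall A B C D (h : pre_hom C D) (g : pre_hom B C)
    (f : pre_hom A B), pre_comp h (pre_comp g f) = pre_comp (pre_comp h g) f;
  pre_comp1f : forall A B (f : pre_hom A B), pre_comp (pre_id B) f = f;
  pre_compf1 : forall A B (f : pre_hom A B), pre_comp f (pre_id A) = f;
  pre_compDl : forall A B C (g g' : pre_hom B C) (f : pre_hom A B),
    pre_comp (g + g') f = pre_comp g f + pre_comp g' f;
  pre_compDr : forall A B C (g : pre_hom B C) (f f' : pre_hom A B),
    pre_comp g (f + f') = pre_comp g f + pre_comp g f' }.

Notation "g \op f" := (pre_comp g f) (at level 50, left associativity).

Record addfunctor (X : preadditive) := AddFunctor {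
  fobj :> X -> zmodType;
  fmap : forall A B : X, pre_hom A B -> fobj B -> fobj A;
  fmapD : forall A B (f : pre_hom A B) x y,
    fmap f (x + y) = fmap f x + fmap f y;
  fmap_id : forall (A : X) x, fmap (pre_id A) x = x;
  fmap_comp : forall A B C (g : pre_hom B C) (f : pre_hom A B) x,
    fmap (g \op f) x = fmap f (fmap g x);
  fmap_addhom : forall A B (f g : pre_hom A B) x,
    fmap (f + g) x = fmap f x + fmap g x }.

Record nattrans (X : preadditive) (F G : addfunctor X) := NatTrans {
  nt_fun :> forall A : X, F A -> G A;
  nt_add : forall (A : X) (x y : F A), nt_fun (x + y) = nt_fun x + nt_fun y;
  nt_nat : forall (A B : X) (f : pre_hom A B) (x : F B),
    nt_fun (fmap f x) = fmap f (nt_fun x) }.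

Arguments nt_fun {X F G} n A x.

Section FunctorCategory.
Variable X : preadditive.

Lemma nattrans_ext (F G : addfunctor X) (s t : nattrans F G) :
  (forall A x, s A x = t A x) -> s = t.
Proof.
case: s t => [s sD sN] [t tD tN] /= st.
have e : s = t by apply: functional_extensionality_dep => A; apply: funext => x.
subst t; congr NatTrans; exact: Prop_irrelevance.
Qed.

Program Definition nt_id (F : addfunctor X) : nattrans F F :=
  @NatTrans X F F (fun A x => x) _ _.

Program Definition nt_comp (F G H : addfunctor X)
    (t : nattrans G H) (s : nattrans F G) : nattrans F H :=
  @NatTrans X F H (fun A x => t A (s A x)) _ _.
Next Obligation. by rewrite !nt_add. Qed.
Next Obligation. by rewrite !nt_nat. Qed.

Program Definition representable (A : X) : addfunctor X :=
  @AddFunctor X (fun B => pre_hom B A) (fun B C f g => g \op f) _ _ _ _.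
Next Obligation. by apply: pre_compDl. Qed.
Next Obligation. by apply: pre_compf1. Qed.
Next Obligation. by apply: pre_compA. Qed.
Next Obligation. by apply: pre_compDr. Qed.

(* Exactness of X(-, B) -> X(-, A) -> F -> 0 in the functor category is
   pointwise. *)
Definition finitely_presented (F : addfunctor X) : Prop :=
  exists (A B : X) (q : nattrans (representable B) (representable A))
         (p : nattrans (representable A) F),
    forall Y : X,
      (forall x : F Y, exists f : pre_hom Y A, p Y f = x) /\
      (forall f : pre_hom Y A,
          p Y f = 0 <-> exists g : pre_hom Y B, q Y g = f).

Record fpfunctor := FpFunctor {
  fp_fun :> addfunctor X;
  fp_presented : finitely_presented fp_fun }.

Program Definition mod_cat : category :=
  @Category fpfunctor (fun F G => nattrans F G)
    (fun F => nt_id F) (fun F G H t s => nt_comp t s) _ _ _.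
Next Obligation. by apply: nattrans_ext. Qed.
Next Obligation. by apply: nattrans_ext. Qed.
Next Obligation. by apply: nattrans_ext. Qed.

End FunctorCategory.

(* A left module over the converse ring L^c is a right module over L:
   with [a *: x] read as x a, one has x (a b) = (x a) b. *)
Notation rmodType L := (lmodType L^c).

(* L as a right module over itself: here [a *: x] is the product x * a of L. *)
Notation regular_rmod L := ((L^c)^o : rmodType L).

Section Hom.
Variables (L : pzRingType) (M N : rmodType L).

Definition homR : Type := {linear M -> N}.
Identity Coercion linear_of_homR : homR >-> GRing.Linear.type.

Lemma homR_ext (f g : homR) : (forall x, f x = g x) -> f = g.
Proof.
case: f g => [f cf] [g cg] /= fg.
have e : f = g by apply: funext.
subst g; congr GRing.Linear.Pack.
case: cf cg => [[a] [b]] [[c] [d]].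
by congr GRing.Linear.Class; congr (_ _); exact: Prop_irrelevance.
Qed.

HB.instance Definition _ := gen_eqMixin homR.
HB.instance Definition _ := gen_choiceMixin homR.

Definition homR0 : homR := [the {linear M -> N} of \0].
Definition homRN (f : homR) : homR := [the {linear M -> N} of \- f].
Definition homRD (f g : homR) : homR := [the {linear M -> N} of f \+ g].

Fact homR_addA : associative homRD.
Proof. by move=> f g h; apply: homR_ext => x; apply: addrA. Qed.
Fact homR_addC : commutative homRD.
Proof. by move=> f g; apply: homR_ext => x; apply: addrC. Qed.
Fact homR_add0 : left_id homR0 homRD.
Proof. by move=> f; apply: homR_ext => x; apply: add0r. Qed.
Fact homR_addN : left_inverse homR0 homRN homRD.
Proof. by move=> f; apply: homR_ext => x; apply: addNr. Qed.

HB.instance Definition _ :=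
  GRing.isZmodule.Build homR homR_addA homR_addC homR_add0 homR_addN.

End Hom.

Definition homR_id (L : pzRingType) (M : rmodType L) : homR M M :=
  [the {linear M -> M} of idfun].
Definition homR_comp (L : pzRingType) (M N P : rmodType L)
  (g : homR N P) (f : homR M N) : homR M P :=
  [the {linear M -> P} of g \o f].

Section Modules.
Variable L : pzRingType.

Definition fg_mod (M : rmodType L) : Prop :=
  exists (n : nat) (s : 'I_n -> M),
    forall x : M, exists a : 'I_n -> L^c, x = \sum_(i < n) a i *: s i.

Definition projective_mod (P : rmodType L) : Prop :=
  forall (A B : rmodType L) (e : {linear A -> B}),
    (forall b, exists a, e a = b) ->
    forall f : {linear P -> B},
      exists g : {linear P -> A}, forall x, e (g x) = f x.

Definition fg_proj (P : rmodType L) : Prop := fg_mod P /\ projective_mod P.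

Definition iso_mod (M N : rmodType L) : Prop :=
  exists f : {linear M -> N}, bijective f.

Definition zero_mod (M : rmodType L) : Prop := forall x : M, x = 0.

Definition indecomposable (M : rmodType L) : Prop :=
  ~ zero_mod M /\
  forall A B : rmodType L, iso_mod M (A * B)%type -> zero_mod A \/ zero_mod B.

Record complex := Complex {
  cx_obj :> int -> rmodType L;
  cx_d : forall i : int, {linear cx_obj i -> cx_obj (i + 1)};
  cx_dd : forall i x, cx_d (i + 1) (cx_d i x) = 0 }.

Definition acyclic (P : complex) : Prop :=
  forall i (x : P (i + 1)), cx_d P (i + 1) x = 0 -> exists y, cx_d P i y = x.

(* Acyclicity of Hom_L(P, L), whose differentials are precomposition with
   those of P. *)
Definition dual_acyclic (P : complex) : Prop :=
  forall i (f : {linear P (i + 1) -> regular_rmod L}),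
    (forall x, f (cx_d P i x) = 0) ->
    exists g : {linear P (i + 1 + 1) -> regular_rmod L},
      forall x, f x = g (cx_d P (i + 1) x).

(* u identifies M with the kernel of the i-th differential. *)
Definition is_syzygy (P : complex) (i : int) (M : rmodType L) : Prop :=
  exists u : {linear M -> P i},
    injective u /\ forall x, cx_d P i x = 0 <-> exists m, u m = x.

Definition gorenstein_projective (M : rmodType L) : Prop :=
  fg_mod M /\
  exists P : complex,
    [/\ forall i, fg_proj (P i), acyclic P, dual_acyclic P &
        exists i, is_syzygy P i M].

Definition contravariantly_finite (X : rmodType L -> Prop) : Prop :=
  forall M : rmodType L, fg_mod M ->
    exists (G : rmodType L) (g : {linear G -> M}), X G /\
      forall (G' : rmodType L) (f : {linear G' -> M}), X G' ->
        exists h : {linear G' -> G}, forall x, f x = g (h x).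

(* The N i may include superfluous modules; only finiteness up to isomorphism
   matters. *)
Definition cm_finite : Prop :=
  exists (m : nat) (N : 'I_m -> rmodType L),
    forall M : rmodType L,
      gorenstein_projective M -> indecomposable M -> exists i, iso_mod M (N i).

End Modules.

Section Stable.
Variable L : pzRingType.

Definition factors_proj (M N : rmodType L) (f : homR M N) : Prop :=
  exists (P : rmodType L) (h : homR P N) (g : homR M P),
    fg_proj P /\ f = homR_comp h g.

Definition proj_ideal (M N : rmodType L) : {pred homR M N} :=
  [pred f | `[< factors_proj f >]].


Lemma fg_proj0 : fg_proj ('rV[L^c]_0 : rmodType L).
Proof.
split.
  by exists 0%N, (fun=> 0) => x; exists (fun=> 0); rewrite big_ord0 thinmx0.
move=> A B e _ f; exists [the {linear _ -> A} of \0] => x.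
by rewrite (thinmx0 x) !linear0.
Qed.

Lemma fg_proj_prod (P Q : rmodType L) :
  fg_proj P -> fg_proj Q -> fg_proj (P * Q)%type.
Proof.
move=> [[m [s sP]] pP] [[n [t tQ]] pQ]; split.
  exists (m + n)%N, (fun i => match split i with
                              | inl j => (s j, 0) | inr j => (0, t j) end).
  move=> [x y]; have [a ->] := sP x; have [b ->] := tQ y.
  exists (fun i => match split i with inl j => a j | inr j => b j end).
  rewrite big_split_ord /=.
  rewrite (eq_bigr (fun i => (a i *: s i, 0 : Q))); last first.
    by move=> i _; rewrite (unsplitK (inl i)) -[0 in RHS](scaler0 _ (a i)).
  rewrite [X in _ + X](eq_bigr (fun i => (0 : P, b i *: t i))); last first.
    by move=> i _; rewrite (unsplitK (inr i)) -[0 in RHS](scaler0 _ (b i)).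
  rewrite [RHS]surjective_pairing; congr (_, _) => /=.
    by rewrite !raddf_sum /= big1_eq addr0.
  by rewrite !raddf_sum /= big1_eq add0r.
move=> A B e e_surj f.
have linl : linear (fun x : P => f (x, 0)).
  by move=> a x y; rewrite -linearP; congr (f _); congr (_, _);
     rewrite /= scaler0 addr0.
have linr : linear (fun y : Q => f (0, y)).
  by move=> a x y; rewrite -linearP; congr (f _); congr (_, _);
     rewrite /= scaler0 addr0.
pose fl : {linear P -> B} :=
  HB.pack (fun x : P => f (x, 0)) (GRing.isLinear.Build _ _ _ _ _ linl).
pose fr : {linear Q -> B} :=
  HB.pack (fun y : Q => f (0, y)) (GRing.isLinear.Build _ _ _ _ _ linr).
have [g gE] := pP A B e e_surj fl; have [h hE] := pQ A B e e_surj fr.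
exists [the {linear (P * Q)%type -> A} of (g \o fst) \+ (h \o snd)] => -[x y].
rewrite /= linearD gE hE /= -linearD; congr (f _); congr (_, _) => /=.
  by rewrite addr0.
by rewrite add0r.
Qed.

Fact proj_ideal_zmod M N : zmod_closed (@proj_ideal M N).
Proof.
split.
  apply/asboolP; exists 'rV[L^c]_0, 0, 0; split; first exact: fg_proj0.
  by apply: homR_ext => x.
move=> _ _ /asboolP[P [h [g [pP ->]]]] /asboolP[Q [h' [g' [pQ ->]]]].
apply/asboolP; exists (P * Q)%type.
have lg : linear (fun x : M => (g x, g' x)).
  by move=> a x y; rewrite !linearP.
pose gg : {linear M -> (P * Q)%type} :=
  HB.pack (fun x : M => (g x, g' x)) (GRing.isLinear.Build _ _ _ _ _ lg).
exists [the {linear (P * Q)%type -> N} of (h \o fst) \+ (\- (h' \o snd))], gg.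
by split; [exact: fg_proj_prod | exact: homR_ext].
Qed.
HB.instance Definition _ M N :=
  GRing.isZmodClosed.Build (homR M N) (@proj_ideal M N) (proj_ideal_zmod M N).

Definition stable_hom (M N : rmodType L) : zmodType :=
  {ideal_quot (@proj_ideal M N)}.

Definition stable_pi (M N : rmodType L) (f : homR M N) : stable_hom M N :=
  \pi f.

Lemma stable_piP (M N : rmodType L) (f g : homR M N) :
  stable_pi f = stable_pi g <-> factors_proj (f - g).
Proof.
split=> [/eqP|fg]; first by rewrite -Quotient.idealrBE => /asboolP.
by apply/eqP; rewrite -Quotient.idealrBE; apply/asboolP.
Qed.

Lemma stable_piD (M N : rmodType L) (f g : homR M N) :
  stable_pi (f + g) = stable_pi f + stable_pi g.
Proof. exact: raddfD. Qed.

Lemma stable_pi_ind (M N : rmodType L) (Q : stable_hom M N -> Prop) :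
  (forall f, Q (stable_pi f)) -> forall u, Q u.
Proof. by move=> H u; rewrite -[u]reprK; apply: H. Qed.

Definition stable_comp (M N P : rmodType L)
    (v : stable_hom N P) (u : stable_hom M N) : stable_hom M P :=
  stable_pi (homR_comp (repr v) (repr u)).

Lemma stable_comp_pi (M N P : rmodType L) (g : homR N P) (f : homR M N) :
  stable_comp (stable_pi g) (stable_pi f) = stable_pi (homR_comp g f).
Proof.
apply/stable_piP.
have /stable_piP[P1 [h1 [k1 [p1 e1]]]] :
    stable_pi (repr (stable_pi g)) = stable_pi g by exact: reprK.
have /stable_piP[P2 [h2 [k2 [p2 e2]]]] :
    stable_pi (repr (stable_pi f)) = stable_pi f by exact: reprK.
move: (repr _) (repr _) e1 e2 => f' g' e1 e2.
have -> : homR_comp g' f' - homR_comp g f =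
    homR_comp (g' - g) f' + homR_comp g (f' - f).
  apply: homR_ext => x.
  rewrite -[LHS]/(g' (f' x) - g (f x)).
  rewrite -[RHS]/(g' (f' x) - g (f' x) + g (f' x - f x)).
  by rewrite linearB addrA subrK.
suff /asboolP : homR_comp (g' - g) f' + homR_comp g (f' - f)
    \in @proj_ideal M P by [].
apply: rpredD; apply/asboolP.
  by exists P1, h1, (homR_comp k1 f'); rewrite e1; split=> //; apply: homR_ext.
by exists P2, (homR_comp g h2), k2; rewrite e2; split=> //; apply: homR_ext.
Qed.

Record gprj := Gprj {
  gprj_mod :> rmodType L;
  gprj_gorenstein : gorenstein_projective gprj_mod }.

Program Definition stable_gprj : preadditive :=
  @Preadditive gprj (fun M N => stable_hom M N)
    (fun M => stable_pi (homR_id M)) (fun M N P v u => stable_comp v u)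
    _ _ _ _ _.
Next Obligation.
elim/stable_pi_ind: f => f; elim/stable_pi_ind: g => g.
elim/stable_pi_ind: h => h; rewrite !stable_comp_pi.
by congr stable_pi; apply: homR_ext.
Qed.
Next Obligation.
elim/stable_pi_ind: f => f; rewrite stable_comp_pi.
by congr stable_pi; apply: homR_ext.
Qed.
Next Obligation.
elim/stable_pi_ind: f => f; rewrite stable_comp_pi.
by congr stable_pi; apply: homR_ext.
Qed.
Next Obligation.
elim/stable_pi_ind: f => f; elim/stable_pi_ind: g => g.
elim/stable_pi_ind: g' => g'.
rewrite -stable_piD !stable_comp_pi -stable_piD.
by congr stable_pi; apply: homR_ext.
Qed.
Next Obligation.
elim/stable_pi_ind: f => f; elim/stable_pi_ind: g => g.
elim/stable_pi_ind: f' => f'.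
rewrite -stable_piD !stable_comp_pi -stable_piD.
by congr stable_pi; apply: homR_ext => x; apply: linearD.
Qed.

End Stable.

Definition is_ideal (R : comPzRingType) (I : R -> Prop) : Prop :=
  [/\ I 0, forall x y, I x -> I y -> I (x + y) & forall a x, I x -> I (a * x)].

Definition artinian (R : comPzRingType) : Prop :=
  forall I : nat -> R -> Prop,
    (forall n, is_ideal (I n)) -> (forall n x, I n.+1 x -> I n x) ->
    exists N, forall n x, (N <= n)%N -> I N x -> I n x.

(* The structure morphism phi is used instead of [algType] because the latter
   excludes the zero ring. *)
Definition artin_algebra (L : pzRingType) : Prop :=
  exists (R : comPzRingType) (phi : {rmorphism R -> L}),
    [/\ artinian R,
        forall r x, phi r * x = x * phi r &
        exists (n : nat) (s : 'I_n -> L),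
          forall x, exists a : 'I_n -> R, x = \sum_(i < n) phi (a i) * s i].

Definition omegaG_algebra (L : pzRingType) : Prop :=
  [/\ artin_algebra L,
      contravariantly_finite (@gorenstein_projective L) &
      semisimple_abelian (mod_cat (stable_gprj L))].

Section LowerTriangular.
Variables (n : nat) (L : pzRingType).

Definition trigmx : {pred 'M[L]_n} := [pred A | is_trig_mx A].

Fact trigmx_subring : subring_closed trigmx.
Proof.
split=> [|A B /is_trig_mxP hA /is_trig_mxP hB|A B /is_trig_mxP hA /is_trig_mxP hB].
- exact: scalar_mx_is_trig.
- by apply/is_trig_mxP => i j ij; rewrite !mxE hA // hB // subr0.
apply/is_trig_mxP => i j ij; rewrite mxE big1 // => k _.
have [ik|ki] := ltnP i k; first by rewrite hA // mul0r.
by rewrite hB ?mulr0 // (leq_ltn_trans ki).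
Qed.
HB.instance Definition _ :=
  GRing.isSubringClosed.Build 'M[L]_n trigmx trigmx_subring.

(* T_n(L), the path algebra over L of the linear quiver with n vertices. *)
Record trig_ring := TrigRing { trig_val :> 'M[L]_n; _ : trig_val \in trigmx }.
HB.instance Definition _ := [isSub for trig_val].
HB.instance Definition _ := [Choice of trig_ring by <:].
HB.instance Definition _ :=
  GRing.SubChoice_isSubPzRing.Build 'M[L]_n trigmx trig_ring trigmx_subring.

End LowerTriangular.

(* Main.v *)
(** By semisimplicity every morphism f of Gorenstein projectives is regular in
    the stable category: f g f = f for some g, because the cokernel functor of f
    is projective.  Hence finitely many modules G_i, namely approximations of the
    simple modules, generate the stable category.  A Gorenstein projective
    T_n(L)-module M is a chain M_(n-1) -> ... -> M_0 of Gorenstein projective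
    L-modules along which maps to projectives extend.  Take k >= j with
    M_k -> M_j stably nonzero and k - j maximal.  Composing it with a suitable
    G_i -> M_k and a quasi-inverse M_j -> G_i gives a non-nilpotent endomorphism
    of M factoring through the module
    (0, ..., 0, G_i = ... = G_i -> P_i = ... = P_i), where P_i is a left
    projective approximation of G_i.  If M is indecomposable, this endomorphism
    is bijective by Fitting's lemma, so M is a summand of one of finitely many
    modules of finite length.  If all the M_k are projective the same argument
    works with L in place of G_i. *)

From HB Require Import structures.
From mathcomp Require Import all_boot all_algebra.
From mathcomp Require Import boolp classical_sets zify.
Require Import Defs.

Set Implicit Arguments.
Unset Strict Implicit.
Unset Printing Implicit Defensive.

Import GRing.Theory.
Local Open Scope ring_scope.
Local Open Scope quotient_scope.

(** * Composition series over Artinian rings *)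

(** Stably zero maps are handled as [finrank] maps, finite sums of rank one maps, so that extending
    or correcting a map only involves finitely many functionals. Maximality of k - j is what makes
    the factorization through the interval module possible. Since M_(k+1) -> M_j has finite rank,
    the quasi-inverse M_j -> G_i can be changed by a finite rank map until it kills all levels above
    k; this explains the zeros. Since M_k -> M_(j-1) has finite rank, G_i -> M_(j-1) extends to P_i;
    this explains the P_i. Neither correction disturbs f h f = f modulo finite rank, so the
    endomorphism stays non-nilpotent on level k. The delicate point is the passage from T_n(L) to
    the levels: exactness of the dual complex is given over T_n(L) only, so a functional on one
    level must first be extended to a cocycle on level 0. Finite length comes from the commutative
    base ring: length functions on its submodules restrict to submodules over the algebra. *)

Definition submod (A : pzRingType) (M : lmodType A) (U : M -> Prop) : Prop :=
  [/\ U 0, forall x y, U x -> U y -> U (x + y) & forall a x, U x -> U (a *: x)].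

Section Submod.
Variables (A : pzRingType) (M : lmodType A) (U : M -> Prop).
Hypothesis sU : submod U.

Lemma submod0 : U 0. Proof. by case: sU. Qed.
Lemma submodD x y : U x -> U y -> U (x + y). Proof. by case: sU => _ h _; apply: h. Qed.
Lemma submodZ a x : U x -> U (a *: x). Proof. by case: sU => _ _; apply. Qed.
Lemma submodN x : U x -> U (- x).
Proof. by rewrite -scaleN1r; apply: submodZ. Qed.
Lemma submodB x y : U x -> U y -> U (x - y).
Proof. by move=> Ux /submodN; apply: submodD. Qed.
Lemma submodDl x y : U y -> U (x + y) -> U x.
Proof. by move=> Uy Uxy; rewrite -(addrK y x); apply: submodB. Qed.
Lemma submod_sum I (r : seq I) (P : pred I) (F : I -> M) :
  (forall i, P i -> U (F i)) -> U (\sum_(i <- r | P i) F i).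
Proof. by move=> h; elim/big_ind: _ => //; [apply: submod0 | apply: submodD]. Qed.
End Submod.

Lemma submod_add_cyclic (A : pzRingType) (M : lmodType A) (U : M -> Prop) (y : M) :
  submod U -> submod (fun x => exists c, U (x - c *: y)).
Proof.
move=> sU; split.
- by exists 0; rewrite scale0r subr0; apply: submod0.
- move=> x z [c Uc] [d Ud]; exists (c + d).
  by rewrite scalerDl opprD addrACA; apply: submodD.
- move=> a x [c Uc]; exists (a * c).
  by rewrite -scalerA -scalerBr; apply: submodZ.
Qed.

Lemma submod_eq0 (A : pzRingType) (M : lmodType A) :
  submod (fun x : M => x = 0).
Proof. by split=> [//|x y -> ->|a x ->]; rewrite ?addr0 ?scaler0. Qed.

(** Anything outside [I] generates the ring modulo [I]. Properness is left out, so the whole ring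
    qualifies. *)
Definition maximal_left_ideal (A : pzRingType) (I : A -> Prop) : Prop :=
  submod (I : A^o -> Prop) /\ forall a, ~ I a -> exists b, I (1 - b * a).

Section Filtered.
Variable A : pzRingType.
Implicit Types (MM : (A -> Prop) -> Prop) (M : lmodType A).

(* The steps are simple or trivial: U + A y / U is a quotient of A / I. *)
Inductive filtered MM M : (M -> Prop) -> Prop :=
| filtered0 : filtered MM (fun x : M => x = 0)
| filteredS (U : M -> Prop) (y : M) (I : A -> Prop) :
    filtered MM U -> MM I -> (forall c, I c -> U (c *: y)) ->
    filtered MM (fun x => exists c, U (x - c *: y)).

Lemma filtered_submod MM M (U : M -> Prop) : filtered MM U -> submod U.
Proof.
by elim=> [|{}U y I _ sU _ _]; [apply: submod_eq0 | apply: submod_add_cyclic].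
Qed.

Lemma eq_filtered MM M (U V : M -> Prop) :
  (forall x, U x <-> V x) -> filtered MM U -> filtered MM V.
Proof. by move=> UV; suff -> : U = V by []; apply/funext=> x; apply/propext. Qed.

Lemma filtered_sub MM MM' M (U : M -> Prop) :
  (forall I, MM I -> MM' I) -> filtered MM U -> filtered MM' U.
Proof.
move=> h; elim=> [|{}U y I _ fU mI Iy]; first exact: filtered0.
by apply: (filteredS fU (h _ mI)).
Qed.

(** Applied to the ring itself, this yields the finite list of simple modules whose approximations
    will generate the stable category. *)
Lemma filtered_finite MM M (U : M -> Prop) : filtered MM U ->
  exists (r : nat) (J : 'I_r -> (A -> Prop)),
    (forall i, MM (J i)) /\ filtered (fun I => exists i, I = J i) U.
Proof.
elim=> [|{}U y I _ [r [J [mJ fU]]] mI Iy].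
  by exists 0%N, (fun=> fun=> True); split; [case | apply: filtered0].
exists r.+1, (fun i => oapp J I (unlift ord0 i)); split.
  by move=> i; case: unliftP => [j _|_] /=.
apply: (@filteredS _ _ _ _ I) => //; last first.
  by exists ord0; rewrite unlift_none.
apply: filtered_sub fU => _ [i ->]; exists (lift ord0 i).
by rewrite liftK.
Qed.

(** The series of the left ideal [V] is carried along v |-> v z and stacked on top of [U]. *)
Lemma filtered_add_gen MM M (U : M -> Prop) (z : M) (V : A^o -> Prop) :
  filtered MM V -> filtered MM U ->
  filtered MM (fun x => exists2 v : A, V v & U (x - v *: z)).
Proof.
move=> fV fU; elim: fV => [|{}V y I fV IH mI Iy].
  apply: eq_filtered fU => x; split=> [Ux|[v ->]]; last by rewrite scale0r subr0.
  by exists 0 => //; rewrite scale0r subr0.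
have Iyz c : I c -> exists2 v : A, V v & U (c *: ((y : A) *: z) - v *: z).
  move=> Ic; exists (c *: y); first exact: Iy.
  by rewrite scalerA subrr; apply: submod0 (filtered_submod fU).
apply: eq_filtered (filteredS IH mI Iyz) => x; split.
  move=> [c [v Vv Ux]]; exists (v + c *: y).
    by exists c; rewrite addrK.
  by rewrite scalerDl opprD addrA addrAC -scalerA.
move=> [v [c Vv] Ux]; exists c, (v - c *: y) => //.
by rewrite scalerBl -scalerA opprB addrA subrK.
Qed.

(** Generation is phrased through submodules, so that it also applies after restriction of scalars
    without explicit coefficients. *)
Lemma filtered_gen MM M (T : finType) (s : T -> M) :
  filtered MM (fun _ : A^o => True) ->
  (forall U : M -> Prop, submod U -> (forall i, U (s i)) -> forall x, U x) ->
  filtered MM (fun _ : M => True).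
Proof.
move=> fA gen.
suff [U fU Us] : exists2 U : M -> Prop, filtered MM U & forall i, i \in enum T -> U (s i).
  apply: (eq_filtered _ fU) => x; split=> // _; apply: (gen U) (filtered_submod fU) _ _ => i.
  by apply: Us; rewrite mem_enum.
elim: (enum T) => [|i r [U fU Us]]; first by exists (fun x => x = 0) => //; apply: filtered0.
exists (fun x => exists2 v : A, True & U (x - v *: s i)).
  exact: filtered_add_gen.
move=> j; rewrite inE => /orP[/eqP->|jr].
  by exists 1 => //; rewrite scale1r subrr; apply: submod0 (filtered_submod fU).
by exists 0 => //; rewrite scale0r subr0; apply: Us.
Qed.

Lemma fg_filtered MM M :
  filtered MM (fun _ : A^o => True) ->
  (exists (m : nat) (s : 'I_m -> M),
     forall x, exists a : 'I_m -> A, x = \sum_(i < m) a i *: s i) ->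
  filtered MM (fun _ : M => True).
Proof.
move=> fA [m [s gen]]; apply: (filtered_gen (s := s) fA) => U sU Us x.
have [a ->] := gen x; apply: submod_sum => // i _; exact: submodZ.
Qed.

End Filtered.

Section Artinian.
Variable R : comPzRingType.
Hypothesis artR : artinian R.

(** Without a minimal member, choice produces a strictly descending chain from [I0]. *)
Lemma artinian_min (Q : (R -> Prop) -> Prop) (I0 : R -> Prop) :
  (forall I, Q I -> is_ideal I) -> Q I0 ->
  exists2 I, Q I & forall J, Q J -> (forall x, J x -> I x) -> forall x, I x -> J x.
Proof.
move=> Qid QI0; apply: contrapT => nmin.
have step (K : {I | Q I}) : exists J : {I | Q I},
    (forall x, sval J x -> sval K x) /\ exists x, sval K x /\ ~ sval J x.
  apply: contrapT => nJ; apply: nmin; exists (sval K); first exact: svalP.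
  move=> J QJ JK x Kx; apply: contrapT => nJx; apply: nJ.
  by exists (exist _ J QJ); split=> //; exists x.
have [f fP] := choice step.
pose s n := iter n f (exist _ I0 QI0).
have [N sN] := artR (fun n => Qid _ (svalP (s n))) (fun n => proj1 (fP (s n))).
have [x [sNx]] := proj2 (fP (s N)).
by apply; apply: (sN N.+1).
Qed.

(** The descending chain of ideals generated by the powers of [a] stabilizes. *)
Lemma artinian_power (a : R) : exists n b, a ^+ n * (1 - b * a) = 0.
Proof.
pose I n (x : R) := exists c, x = c * a ^+ n.
have idI n : is_ideal (I n).
  split; first by exists 0; rewrite mul0r.
    by move=> _ _ [c ->] [d ->]; exists (c + d); rewrite mulrDl.
  by move=> d _ [c ->]; exists (d * c); rewrite mulrA.
have dec n x : I n.+1 x -> I n x.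
  by move=> [c ->]; exists (c * a); rewrite exprS mulrA.
have [N /(_ N.+1) hN] := artR idI dec.
have [||c hc] // := hN (a ^+ N); first by exists 1; rewrite mul1r.
exists N, c; apply/eqP; rewrite mulrBr mulr1 subr_eq0; apply/eqP.
by rewrite {1}hc exprSr mulrCA.
Qed.

Let good (K : R -> Prop) := filtered (@maximal_left_ideal R) (K : R^o -> Prop).

Lemma ideal_submod (K : R -> Prop) : is_ideal K <-> submod (K : R^o -> Prop).
Proof. by split=> -[h0 hD hZ]; split. Qed.

(** Multiplication by [r] presents [K] as an extension of r K by its kernel. The series of r K is
    pulled back step by step on top of that of the kernel, each generator y being lifted to some k0
    with y = r k0. *)
Lemma good_mul_image (K : R -> Prop) (r : R) : is_ideal K ->
  good (fun k => K k /\ r * k = 0) -> good (fun x => exists2 k, K k & x = r * k) ->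
  good K.
Proof.
move=> idK gker gim.
have [_ KD KZ] := idK.
suff H (V : R^o -> Prop) : filtered (@maximal_left_ideal R) V ->
    (forall x, V x -> exists2 k, K k & x = r * k) ->
    good (fun k => K k /\ V (r * k)).
  apply: eq_filtered (H _ gim _) => //= k; split=> [[]//|Kk].
  by split=> //; exists k.
elim=> [|{}V y I fV IH mI Iy] sub //.
have sV := filtered_submod fV.
have VK x : V x -> exists2 k, K k & x = r * k.
  by move=> Vx; apply: sub; exists 0; rewrite scale0r subr0.
have [k0 Kk0 yk0] : exists2 k, K k & y = r * k.
  by apply: sub; exists 1; rewrite scale1r subrr; apply: submod0.
have rc (c k : R) : r * (k - c * k0) = r * k - c *: y.
  by rewrite mulrBr /= [c *: _]/(c * _) yk0 mulrCA.
have Iyk (c : R) : I c -> K (c * k0) /\ V (r * (c * k0)).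
  by move=> Ic; split; [exact: KZ | rewrite mulrCA -yk0; apply: Iy].
apply: eq_filtered (filteredS (y := k0 : R^o) (IH VK) mI Iyk) => k; split.
  move=> [c [Kc Vc]]; split; last by exists c; rewrite -rc.
  by rewrite -(subrK (c *: (k0 : R^o)) k); apply: KD => //; apply: KZ.
move=> [Kk [c Vc]]; exists c; split; last by rewrite rc.
by apply: KD => //; rewrite -mulN1r; exact/KZ/KZ.
Qed.

(* If some ideal had no composition series, take a minimal such ideal K.  Every
   r in R acts on K as zero or surjectively, so the annihilator of K is maximal,
   and a hyperplane of the vector space K gives a contradiction. *)
Lemma artinian_filtered :
  filtered (@maximal_left_ideal R) (fun _ : R^o => True).
Proof.
apply: contrapT => nR.
have [I []//||K [idK nK] minK] :=
  @artinian_min (fun K => is_ideal K /\ ~ good K) (fun=> True : Prop).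
  by split=> //; split.
have sK := (ideal_submod K).1 idK.
have [K0 KD KZ] := idK.
have goodK J : is_ideal J -> (forall x, J x -> K x) ->
    (exists2 x, K x & ~ J x) -> good J.
  move=> idJ JK [x Kx nJx]; apply: contrapT => nJ.
  by apply: nJx; apply: (minK J).
(* Otherwise the kernel and the image of [r] on [K] are both strictly smaller than [K]; by
   minimality they have series, which combine into one for [K]. *)
have dich r : (forall k, K k -> r * k = 0) \/
    (forall k, K k -> exists2 l, K l & k = r * l).
  apply: contrapT => /not_orP[/existsNP[k0 /not_implyP[Kk0 rk0]]].
  move=> /existsNP[k1 /not_implyP[Kk1 rk1]].
  apply: nK; apply: (good_mul_image (r := r)) => //; apply: goodK.
  - split; first by rewrite mulr0.
      by move=> x y [Kx rx] [Ky ry]; rewrite mulrDr rx ry addr0; split=> //; apply: KD.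
    by move=> a x [Kx rx]; rewrite mulrCA rx mulr0; split=> //; apply: KZ.
  - by move=> x [].
  - by exists k0 => // -[].
  - split; first by exists 0; rewrite ?mulr0.
      by move=> _ _ [k Kk ->] [l Kl ->]; exists (k + l); [apply: KD | rewrite mulrDr].
    by move=> a _ [k Kk ->]; exists (a * k); [apply: KZ | rewrite mulrCA].
  - by move=> _ [k Kk ->]; apply: KZ.
  - by exists k1.
pose P r := forall k, K k -> r * k = 0.
have maxP : maximal_left_ideal P.
  split.
    split; first by move=> k _; rewrite mul0r.
      by move=> a b Pa Pb k Kk; rewrite mulrDl Pa // Pb // addr0.
    by move=> a b Pb k Kk; rewrite -mulrA Pb // mulr0.
  move=> a nPa; have [//|surj] := dich a.
  have [n [b eqb]] := artinian_power a; exists b => k Kk.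
  have [l Kl ->] : exists2 l, K l & k = a ^+ n * l.
    elim: n {eqb} => [|n [l Kl ->]]; first by exists k; rewrite // expr0 mul1r.
    by have [m Km ->] := surj l Kl; exists m; rewrite // exprSr mulrA.
  by rewrite mulrA (mulrC _ (a ^+ n)) eqb mul0r.
have [x Kx nx] : exists2 x, K x & x <> 0.
  apply: contrapT => nx; apply: nK; apply: eq_filtered (filtered0 _ _) => k.
  split=> [->//|Kk]; apply: contrapT => k0; apply: nx; by exists k.
pose SS (H : R -> Prop) :=
  [/\ is_ideal H, forall y, H y -> K y & ~ H x] \/ forall y, ~ H y.
have [F FS totF|H [SH maxH]] := @Zorn_bigcup _ SS.
  have [[H0 [FH0 H0i]]|nF] := pselect (exists H, F H /\ is_ideal H); last first.
    right=> y [H FH Hy]; apply: nF; exists H; split=> //.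
    by case: (FS H FH) => [[]//|/(_ _ Hy)].
  left; split.
  - split; first by exists H0 => //; case: H0i.
      move=> a b [H1 FH1 Ha] [H2 FH2 Hb].
      have [sub|sub] := totF H1 H2 FH1 FH2.
        exists H2 => //; case: (FS H2 FH2) => [[[_ D _] _ _]|/(_ _ Hb)//].
        by apply: D => //; apply: sub.
      exists H1 => //; case: (FS H1 FH1) => [[[_ D _] _ _]|/(_ _ Ha)//].
      by apply: D => //; apply: sub.
    move=> a b [H1 FH1 Hb]; exists H1 => //.
    case: (FS H1 FH1) => [[[_ _ Z] _ _]|/(_ _ Hb)//].
    exact: Z.
  - move=> y [H1 FH1 Hy]; case: (FS H1 FH1) => [[_ s _]|/(_ _ Hy)//].
    exact: s.
  - move=> [H1 FH1 Hx]; case: (FS H1 FH1) => [[_ _]|/(_ _ Hx)//].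
    exact.
case: SH => [[idH HK nHx]|H0]; last first.
  have [] := maxH (fun z => z = 0).
    by split=> [z /H0//|/(_ 0 erefl)/H0].
  left; split=> [|_ ->//|/= x0]; last exact: nx.
  by split=> [//|_ _ -> ->|a _ ->]; rewrite ?addr0 ?mulr0.
have sH := (ideal_submod H).1 idH.
have gH : good H by apply: goodK => //; exists x.
apply: nK; apply: eq_filtered (filteredS (y := x : R^o) gH maxP _) => [k|c Pc]; last first.
  by rewrite [c *: _]Pc //; apply: (submod0 sH).
split=> [[c Hc]|Kk].
  by apply: (submodDl sK _ (HK _ Hc)); apply: (submodN sK); apply: KZ.
have [Hk|nHk] := pselect (H k); first by exists 0; rewrite scale0r subr0.
(* H + R k is strictly larger than [H], so it contains [x]. The coefficient [c] does not annihilate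
   [K], hence is invertible modulo [P], and solving for [k] puts it into H + R x. *)
have [c Hc] : exists c, H (x - c * k).
  apply: contrapT => nc.
  have := maxH (fun z => exists c, H (z - c * k)); apply.
    split.
      move=> z Hz; exists 0; by rewrite mul0r subr0.
    move=> /(_ k) sub; apply: nHk; apply: sub; exists 1; rewrite mul1r subrr.
    by apply: (submod0 sH).
  left; split=> //.
    split; first by exists 0; rewrite mul0r subr0; apply: (submod0 sH).
      move=> a b [c Hc] [d Hd]; exists (c + d).
      by rewrite mulrDl opprD addrACA; apply: (submodD sH).
    move=> a b [c Hc]; exists (a * c).
    by rewrite -mulrA -mulrBr; apply: (submodZ sH).
  move=> z [c /HK Kc].
  by apply: (submodDl sK _ Kc); apply: (submodN sK); apply: KZ.
have nPc : ~ P c.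
  by move=> Pc; apply: nHx; move: Hc; rewrite Pc // subr0.
have [b Pb] := maxP.2 c nPc.
have kE : k = b * (c * k).
  by apply/eqP; rewrite mulrA -subr_eq0 -{1}(mul1r k) -mulrBl Pb.
exists b; have -> : k - b *: (x : R^o) = - b * (x - c * k).
  by rewrite {1}kE mulNr mulrBr opprB.
exact: (submodZ sH).
Qed.

End Artinian.

(** * Submodules, quotients and length *)

Definition mklin (A : pzRingType) (M N : lmodType A) (f : M -> N) (lf : linear f) :
  {linear M -> N} := HB.pack f (GRing.isLinear.Build _ _ _ _ f lf).

Section Submodule.
Variables (A : pzRingType) (M : lmodType A) (U : M -> Prop) (sU : submod U).

(** The proof of [submod U] is an argument so that the closure instance can be inferred from the
    predicate alone. *)
Definition subm_pred & submod U : {pred M} := fun x => `[< U x >].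

Lemma subm_closed : submod_closed (subm_pred sU).
Proof.
split; first exact/asboolP/(submod0 sU).
move=> a x y /asboolP Ux /asboolP Uy; apply/asboolP.
by apply: submodD => //; apply: submodZ.
Qed.
HB.instance Definition _ :=
  GRing.isSubmodClosed.Build A M (subm_pred sU) subm_closed.

Record subm := Subm { subm_val :> M; _ : subm_val \in subm_pred sU }.
HB.instance Definition _ := [isSub for subm_val].
HB.instance Definition _ := [Choice of subm by <:].
HB.instance Definition _ :=
  GRing.SubChoice_isSubLmodule.Build A M (subm_pred sU) subm subm_closed.

Lemma submP (x : subm) : U (val x).
Proof. by case: x => x /= /asboolP. Qed.

Definition to_subm x (Ux : U x) : subm := Subm (introT (asboolP _) Ux).

Lemma subm_val_linear : linear (val : subm -> M).
Proof. by []. Qed.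
Definition subm_incl : {linear subm -> M} := mklin subm_val_linear.

Lemma corestr_subproof (N : lmodType A) (f : {linear N -> M}) (h : forall x, U (f x)) :
  linear (fun x => to_subm (h x)).
Proof. by move=> a x y; apply: val_inj; rewrite /= linearP. Qed.
Definition corestr (N : lmodType A) (f : {linear N -> M}) (h : forall x, U (f x)) :
  {linear N -> subm} := mklin (corestr_subproof h).

End Submodule.

Section Quotient.
Variables (A : pzRingType) (M : lmodType A) (U : M -> Prop) (sU : submod U).

Definition quotm : zmodType := {ideal_quot (subm_pred sU)}.
Definition quotm_pi (x : M) : quotm := \pi x.

Lemma quotm_piP x y : quotm_pi x = quotm_pi y <-> U (x - y).
Proof.
split=> [/eqP|h]; first by rewrite -Quotient.idealrBE => /asboolP.
by apply/eqP; rewrite -Quotient.idealrBE; apply/asboolP.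
Qed.

Lemma quotm_pi_surj q : exists x, quotm_pi x = q.
Proof. by exists (repr q); apply: reprK. Qed.

Definition quotm_scale (a : A) (q : quotm) : quotm := quotm_pi (a *: repr q).

Lemma quotm_scale_pi a x : quotm_scale a (quotm_pi x) = quotm_pi (a *: x).
Proof.
apply/quotm_piP; rewrite -scalerBr; apply: (submodZ sU).
by apply/quotm_piP; apply: reprK.
Qed.

Lemma quotm_piD : {morph quotm_pi : x y / x + y}.
Proof. by move=> x y; apply: raddfD. Qed.

Fact quotm_scaleA a b v : quotm_scale a (quotm_scale b v) = quotm_scale (a * b) v.
Proof. by have [x <-] := quotm_pi_surj v; rewrite !quotm_scale_pi scalerA. Qed.
Fact quotm_scale1 : left_id 1 quotm_scale.
Proof. by move=> v; have [x <-] := quotm_pi_surj v; rewrite quotm_scale_pi scale1r. Qed.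
Fact quotm_scaleDr : right_distributive quotm_scale +%R.
Proof.
move=> a v w; have [x <-] := quotm_pi_surj v; have [y <-] := quotm_pi_surj w.
by rewrite -quotm_piD !quotm_scale_pi scalerDr quotm_piD.
Qed.
Fact quotm_scaleDl v : {morph quotm_scale^~ v : a b / a + b}.
Proof.
move=> a b; have [x <-] := quotm_pi_surj v.
by rewrite !quotm_scale_pi scalerDl quotm_piD.
Qed.

Definition quotmod : Type := quotm.
HB.instance Definition _ := GRing.Zmodule.on quotmod.
HB.instance Definition _ := GRing.Zmodule_isLmodule.Build A quotmod
  quotm_scaleA quotm_scale1 quotm_scaleDr quotm_scaleDl.

Lemma quotmod_pi_linear : linear (quotm_pi : M -> quotmod).
Proof. by move=> a x y; rewrite quotm_piD -quotm_scale_pi. Qed.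
Definition quotmod_pi : {linear M -> quotmod} := mklin quotmod_pi_linear.

End Quotient.

Section Restriction.
Variables (A B : pzRingType) (phi : {rmorphism A -> B}) (M : lmodType B).

(** An alias that carries [phi], which keeps the structure over [A] apart from the one over [B]. *)
Definition restr & {rmorphism A -> B} : Type := M.
HB.instance Definition _ := GRing.Zmodule.on (restr phi).

Definition restr_scale (a : A) (x : restr phi) : restr phi := phi a *: (x : M).
Fact restr_scaleA a b v : restr_scale a (restr_scale b v) = restr_scale (a * b) v.
Proof. by rewrite /restr_scale scalerA rmorphM. Qed.
Fact restr_scale1 : left_id 1 restr_scale.
Proof. by move=> v; rewrite /restr_scale rmorph1 scale1r. Qed.
Fact restr_scaleDr : right_distributive restr_scale +%R.
Proof. by move=> a x y; apply: scalerDr. Qed.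
Fact restr_scaleDl v : {morph restr_scale^~ v : a b / a + b}.
Proof. by move=> a b; rewrite /restr_scale rmorphD scalerDl. Qed.
HB.instance Definition _ := GRing.Zmodule_isLmodule.Build A (restr phi)
  restr_scaleA restr_scale1 restr_scaleDr restr_scaleDl.

Lemma restrZE (a : A) (x : restr phi) : a *: x = phi a *: (x : M).
Proof. by []. Qed.

End Restriction.

Section Length.
Variable A : pzRingType.
Implicit Types (M N : lmodType A).

(** A strictly monotone rank on submodules. In this form it survives passing to submodules and to a
    larger ring of scalars. *)
Definition length_fun M (len : (M -> Prop) -> nat) : Prop :=
  forall V W : M -> Prop, submod V -> submod W -> (forall x, V x -> W x) ->
    (len V <= len W)%N /\ ((len W <= len V)%N -> forall x, W x -> V x).

Definition bounded_length (l : nat) M : Prop :=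
  exists2 len : (M -> Prop) -> nat, length_fun len &
    forall V, submod V -> (len V <= l)%N.

Definition finlen M : Prop := exists l, bounded_length l M.

(** The length of [V] counts the steps of the series at which [V] jumps, that is, contains an
    element of the larger term outside the smaller one. *)
Lemma filtered_finlen M :
  filtered (@maximal_left_ideal A) (fun _ : M => True) -> finlen M.
Proof.
pose bnd (U : M -> Prop) := exists l, exists2 len : (M -> Prop) -> nat,
  forall V W : M -> Prop, submod V -> submod W -> (forall x, V x -> W x) ->
    (len V <= len W)%N /\ ((len W <= len V)%N -> forall x, U x -> W x -> V x) &
  forall V, submod V -> (len V <= l)%N.
suff H U : filtered (@maximal_left_ideal A) U -> bnd U.
  move=> /H[l [len h b]]; exists l, len => // V W sV sW VW.
  by have [h1 h2] := h V W sV sW VW; split=> // /h2 h3 x; apply: h3.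
elim=> [|{}U y I fU [l [len h b]] [_ mI] Iy].
  by exists 0%N, (fun=> 0%N) => // V W sV sW VW; split=> // _ x -> _; apply: submod0.
have sU := filtered_submod fU.
pose jump (V : M -> Prop) := exists x, [/\ V x, ~ U x & exists c, U (x - c *: y)].
exists l.+1, (fun V => (len V + `[< jump V >])%N); last first.
  by move=> V /b lV; rewrite -addn1 leq_add // leq_b1.
move=> V W sV sW VW; have [h1 h2] := h V W sV sW VW.
have jVW : (`[< jump V >] <= `[< jump W >])%N.
  case: asboolP => // -[x [Vx nUx Ux]]; case: asboolP => // nW; exfalso; apply: nW.
  by exists x; split=> //; apply: VW.
split; first exact: leq_add.
move=> le x [c Uc] Wx.
have le1 : (len W <= len V)%N by lia.
have le2 : (`[< jump W >] <= `[< jump V >])%N by lia.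
have [Ux|nUx] := pselect (U x); first exact: h2.
have [v [Vv nUv [d Ud]]] : jump V.
  apply/asboolP; move: le2; case: (asboolP (jump W)) => [_|[]]; first by case: asboolP.
  by exists x; split=> //; exists c.
(* The coefficient [d] of a jump is invertible modulo [I], so a multiple of [v] cancels the [y]-part
   of [x] and brings it into [U]. *)
have nId : ~ I d by move=> /Iy; move=> Udy; apply: nUv; rewrite -(subrK (d *: y) v); apply: submodD.
have [e Ie] := mI d nId.
have Uxv : U (x - (c * e) *: v).
  have -> : x - (c * e) *: v = (x - c *: y) + (c *: ((1 - e * d) *: y) - (c * e) *: (v - d *: y)).
    rewrite scalerBl !scalerBr scale1r !scalerA mulrA.
    by rewrite opprB [_ + (_ - _)]addrA subrK addrA subrK.
  apply: (submodD sU) => //; apply: (submodB sU); apply: (submodZ sU) => //; exact: Iy.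
have Vxv : V (x - (c * e) *: v).
  by apply: h2 => //; apply: (submodB sW) => //; apply: (submodZ sW); apply: VW.
by rewrite -(subrK ((c * e) *: v) x); apply: (submodD sV) => //; apply: (submodZ sV).
Qed.

(** The series is built upwards. Among the submodules properly containing [U], one of least length
    is U + A y for any of its elements [y] outside [U], and the annihilator of [y] modulo [U] is
    maximal. *)
Lemma finlen_filtered M :
  finlen M -> filtered (@maximal_left_ideal A) (fun _ : M => True).
Proof.
move=> [l [len lenP bnd]].
suff H k U : filtered (@maximal_left_ideal A) U -> (l - len U <= k)%N ->
    filtered (@maximal_left_ideal A) (fun _ : M => True).
  exact: (H l _ (filtered0 _ _) (leq_subr _ _)).
elim: k U => [|k IH] U fU lU; have sU := filtered_submod fU.
  have sT : submod (fun _ : M => True) by [].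
  have [_ h] := lenP U _ sU sT (fun _ _ => I).
  apply: eq_filtered fU => x; split=> // _; apply: h => //.
  by rewrite (leq_trans (bnd _ _)) // -subn_eq0 -leqn0.
have [full|nfull] := pselect (forall x, U x); first by apply: eq_filtered fU => x.
pose Q m := `[< exists W : M -> Prop, [/\ submod W, (forall x, U x -> W x),
                (exists x, W x /\ ~ U x) & len W = m] >].
have [|m /asboolP[W [sW UW [y [Wy nUy]] lW]] minm] := @ex_minnP Q.
  move/existsNP: nfull => [x nUx]; exists (len (fun=> True)); apply/asboolP.
  by exists (fun=> True); split=> //; exists x.
pose I c := U (c *: y).
have sI : submod (I : A^o -> Prop).
  split; first by rewrite /I scale0r; apply: submod0.
    by move=> a b Ia Ib; rewrite /I scalerDl; apply: submodD.
  by move=> a b Ib; rewrite /I -scalerA; apply: submodZ.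
have sS z := submod_add_cyclic z sU.
have US (z x : M) : U x -> exists c, U (x - c *: z) by exists 0; rewrite scale0r subr0.
have Sz (z : M) : exists c, U (z - c *: z) by exists 1; rewrite scale1r subrr; apply: submod0.
have mI : maximal_left_ideal I.
  split=> // a nIa.
  have SW x : (exists c, U (x - c *: (a *: y))) -> W x.
    move=> [c Uc]; rewrite -(subrK (c *: (a *: y)) x); apply: submodD => //.
      exact: UW.
    by apply: submodZ => //; apply: submodZ.
  have [_ h] := lenP _ W (sS (a *: y)) sW SW.
  have [|c Uc] := h _ y Wy.
    rewrite lW; apply: minm; apply/asboolP.
    exists (fun x => exists c, U (x - c *: (a *: y))).
    by split=> //; [apply: US | exists (a *: y)].
  by exists c; rewrite /I scalerBl scale1r -scalerA.
apply: (IH _ (filteredS (y := y) fU mI (fun _ => id))).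
have [h1 h2] := lenP U _ sU (sS y) (US y).
have : ~~ (len (fun x => exists c, U (x - c *: y)%R) <= len U)%N.
  by apply/negP => /h2 /(_ y (Sz y)).
rewrite -ltnNge => lt; move: lU; rewrite !leq_subLR => lU.
by rewrite (leq_trans lU) // addnS -addSn leq_add2r.
Qed.

Definition lin_image M N (f : {linear M -> N}) (V : M -> Prop) (y : N) : Prop :=
  exists2 x, V x & y = f x.

Lemma submod_image M N (f : {linear M -> N}) V : submod V -> submod (lin_image f V).
Proof.
move=> sV; split; first by exists 0; [apply: submod0 | rewrite linear0].
  move=> _ _ [x Vx ->] [y Vy ->]; exists (x + y); first exact: submodD.
  by rewrite linearD.
by move=> a _ [x Vx ->]; exists (a *: x); [apply: submodZ | rewrite linearZ].
Qed.

Lemma length_fun_image M N (f : {linear M -> N}) len :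
  injective f -> length_fun len -> length_fun (len \o lin_image f).
Proof.
move=> fI lenP V W sV sW VW.
have [|h1 h2] := lenP _ _ (submod_image f sV) (submod_image f sW).
  by move=> _ [x Vx ->]; exists x => //; apply: VW.
split=> // le x Wx; have [|y Vy /fI->//] := h2 le (f x).
by exists x.
Qed.

Lemma finlen_inj M N (f : {linear M -> N}) : injective f -> finlen N -> finlen M.
Proof.
move=> fI [l [len lenP bnd]]; exists l, (len \o lin_image f).
  exact: length_fun_image.
by move=> V /(submod_image f)/bnd.
Qed.

Lemma bounded_length_proper l M N (f : {linear M -> N}) :
  injective f -> (exists y, forall x, f x <> y) ->
  bounded_length l.+1 N -> bounded_length l M.
Proof.
move=> fI [y0 ny0] [len lenP bnd]; exists (len \o lin_image f).
  exact: length_fun_image.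
move=> V /(submod_image f) sV; rewrite -ltnS.
have sT : submod (fun _ : N => True) by [].
apply: (leq_trans _ (bnd _ sT)); rewrite ltnNge; apply/negP => le.
have [_ h] := lenP _ _ sV sT (fun _ _ => I).
by have [x _ /esym/ny0] := h le y0 I.
Qed.

End Length.

(** A length function on the R-submodules of [B] is also one on its left ideals, and length
    functions can be turned back into series over [B]. *)
Lemma fg_filtered_algebra (R : comPzRingType) (B : pzRingType)
    (phi : {rmorphism R -> B}) (T : finType) (s : T -> B) :
  artinian R ->
  (forall U : B -> Prop, U 0 -> (forall x y, U x -> U y -> U (x + y)) ->
     (forall r x, U x -> U (phi r * x)) -> (forall i, U (s i)) -> forall x, U x) ->
  filtered (@maximal_left_ideal B) (fun _ : B^o => True).
Proof.
move=> artR gen; apply: finlen_filtered.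
have [l [len lenP bnd]] : finlen (restr (B^o) phi).
  apply: filtered_finlen.
  apply: (filtered_gen (s := s : T -> restr (B^o) phi) (artinian_filtered artR)).
  by move=> U [U0 UD UZ] Us; apply: gen.
by exists l, len => [V W [V0 VD VZ] [W0 WD WZ]|V [V0 VD VZ]];
   [apply: lenP | apply: bnd]; split=> // a x h; [apply: VZ|apply: WZ|apply: VZ].
Qed.

(** * Indecomposable modules of finite length *)

Lemma inj_surj_bij (T U : Type) (f : T -> U) :
  injective f -> (forall y, exists x, f x = y) -> bijective f.
Proof. by move=> fI /choice[g gK]; exists g => // x; apply: fI. Qed.

Lemma linear_bij_inv (A : pzRingType) (M N : lmodType A) (f : {linear M -> N}) :
  bijective f -> exists2 g : {linear N -> M}, cancel f g & cancel g f.
Proof.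
move=> [g fK gK].
have lg : linear g by move=> a x y; apply: (can_inj fK); rewrite linearP !gK.
by exists (mklin lg).
Qed.

Section Iter.
Variables (A : pzRingType) (M : lmodType A) (f : {linear M -> M}).

Lemma iter_linear m : linear (iter m f).
Proof. by elim: m => [//|m IH] a x y; rewrite !iterS IH linearP. Qed.

Definition liter m : {linear M -> M} := mklin (iter_linear m).

Lemma submod_ker (N : lmodType A) (g : {linear M -> N}) : submod (fun x => g x = 0).
Proof.
split; first exact: linear0.
  by move=> x y gx gy; rewrite linearD gx gy addr0.
by move=> a x gx; rewrite linearZ /= gx scaler0.
Qed.

End Iter.

Section Indecomposable.
Variable L : pzRingType.
Implicit Types (M N : rmodType L).

Lemma indecomposable_split M (U W : M -> Prop) :
  indecomposable M -> submod U -> submod W -> (forall x, U x -> W x -> x = 0) ->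
  (forall x, exists u w, [/\ U u, W w & x = u + w]) ->
  (forall x, U x -> x = 0) \/ (forall x, W x -> x = 0).
Proof.
move=> [_ indM] sU sW UW UWx.
pose g (p : (subm sU * subm sW)%type) : M := val p.1 + val p.2.
have lg : linear g.
  by move=> a [u w] [u' w']; rewrite /g /= scalerDr addrACA.
have [|gi giK gKi] := @linear_bij_inv _ _ _ (mklin lg).
  apply: inj_surj_bij; last first.
    by move=> x; have [u [w [Uu Ww ->]]] := UWx x; exists (to_subm sU Uu, to_subm sW Ww).
  move=> [u w] [u' w'] /= /eqP; rewrite /g /= -subr_eq0 opprD addrACA addr_eq0 => /eqP e.
  have u0 : val u - val u' = 0.
    apply: UW; first by apply: (submodB sU); apply: submP.
    by rewrite e opprB; apply: (submodB sW); apply: submP.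
  move/eqP: e; rewrite u0 eq_sym oppr_eq0 subr_eq0 => /eqP/val_inj->.
  by move/eqP: u0; rewrite subr_eq0 => /eqP/val_inj->.
have [|z|z] := indM (subm sU) (subm sW).
- by exists gi; exists (mklin lg).
- by left=> x Ux; have := congr1 val (z (to_subm sU Ux)).
- by right=> x Ux; have := congr1 val (z (to_subm sW Ux)).
Qed.

(** Among the powers of [f], kernels of maximal length and images of minimal length are stable. From
    then on kernel and image are complementary, and indecomposability kills one of them. *)
Lemma fitting M (f : {linear M -> M}) : indecomposable M -> finlen M ->
  bijective f \/ exists m, forall x, iter m f x = 0.
Proof.
move=> indM [l [len lenP bnd]].
pose K m (x : M) := liter f m x = 0; pose J m := lin_image (liter f m) (fun=> True).
have sK m : submod (K m) by apply: submod_ker.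
have sJ m : submod (J m) by apply: submod_image.
have KS m k x : K m x -> K (k + m)%N x.
  by rewrite /K /= iterD => ->; exact: (linear0 (liter f k)).
have JS m k x : J (k + m)%N x -> J m x.
  by move=> [y _ ->]; exists (iter k f y); rewrite //= -iterD addnC.
have [m1 hm1] : exists m, forall k x, K k x -> K m x.
  pose Q k := `[< exists m, len (K m) = k >].
  have [||_ /asboolP[m <-] maxm] := @ex_maxnP Q l.
  - by exists (len (K 0)); apply/asboolP; exists 0%N.
  - by move=> _ /asboolP[m <-]; apply: bnd.
  exists m => k x /(KS k m)Kx; rewrite addnC in Kx.
  have [_] := lenP _ _ (sK m) (sK (k + m)%N) (KS m k); apply=> //.
  by apply: maxm; apply/asboolP; exists (k + m)%N.
have [m2 hm2] : exists m, forall k x, J m x -> J k x.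
  pose Q k := `[< exists m, len (J m) = k >].
  have [|_ /asboolP[m <-] minm] := @ex_minnP Q.
  - by exists (len (J 0)); apply/asboolP; exists 0%N.
  exists m => k x Jx; apply: (JS k m); rewrite addnC.
  have [_] := lenP _ _ (sJ (k + m)%N) (sJ m) (JS m k); apply=> //.
  by apply: minm; apply/asboolP; exists (k + m)%N.
pose m := (m2 + m1)%N.
have KE k x : K k x -> K m x by move=> /hm1; apply: KS.
have JE k x : J m x -> J k x.
  by rewrite /m addnC => /JS; apply: hm2.
have UW x : exists u w, [/\ K m u, J m w & x = u + w].
  have [y _ yE] : J (m + m)%N (iter m f x) by apply: JE; exists x.
  exists (x - iter m f y), (iter m f y); split; last by rewrite subrK.
    by rewrite /K linearB /= yE /= iterD subrr.
  by exists y.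
have [|z|z] := indecomposable_split indM (sK m) (sJ m) _ UW.
- move=> x Kx [y _ xE]; move: Kx; rewrite xE /K /= -iterD; exact: KE.
- left; apply: inj_surj_bij => [x y /eqP|y].
    rewrite -subr_eq0 -linearB => /eqP fxy; apply/eqP; rewrite -subr_eq0; apply/eqP.
    by apply: z; apply: (KE 1%N).
  have [u [w [/z-> /(JE 1%N)[v _ ->] ->]]] := UW y.
  by exists v; rewrite add0r.
- by right; exists m => x; apply: z; exists x.
Qed.

Lemma indecomposable_retract M N (i : {linear M -> N}) (p : {linear N -> M}) :
  ~ zero_mod M -> indecomposable N -> bijective (p \o i) -> iso_mod M N.
Proof.
move=> nzM indN bij.
have [q qK Kq] := linear_bij_inv (f := p \o i) bij.
have iI : injective i by move=> x y ixy; apply: (can_inj qK); rewrite /= ixy.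
have dec x : p (x - i (q (p x))) = 0.
  by rewrite linearB /=; have /= -> := Kq (p x); rewrite subrr.
have sT : submod (fun _ : M => True) by [].
have [||z|z] := indecomposable_split indN (submod_image i sT) (submod_ker p).
- by move=> _ [x _ ->] pix; rewrite -(qK x) /= pix !linear0.
- move=> x; exists (i (q (p x))), (x - i (q (p x))); split=> //.
    by exists (q (p x)).
  by rewrite addrC subrK.
- by case: nzM => x; apply: iI; rewrite linear0; apply: z; exists x.
exists i; apply: inj_surj_bij => // y.
exists (q (p y)); apply/esym/eqP; rewrite -subr_eq0; apply/eqP; exact: z (dec y).
Qed.

(** The endomorphism ring is local. After division by [h] the two summands add up to the identity;
    if both were nilpotent, a zero of one would be fixed by the other, so the former would be
    injective as well as nilpotent. *)
Lemma bij_addl M (f g h : {linear M -> M}) : indecomposable M -> finlen M ->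
  bijective h -> (forall x, h x = f x + g x) -> bijective f \/ bijective g.
Proof.
move=> indM flM bh hE; have [k hK kK] := linear_bij_inv bh.
have bk (e : {linear M -> M}) : bijective (k \o e) -> bijective e.
  move=> bke; apply: (@eq_bij _ _ (h \o (k \o e))); last by move=> x /=; rewrite kK.
  exact: bij_comp.
have [/bk|[m fm]] := @fitting M (k \o f) indM flM; first by left.
have [/bk|[l gl]] := @fitting M (k \o g) indM flM; first by right.
have kgE x : k (f x) + k (g x) = x by rewrite -linearD -hE hK.
case: indM => nz _; case: nz => x; apply/eqP; apply: contraT => nx.
have kg y : k (g y) = 0 -> y = 0.
  move=> e; have fy : k (f y) = y by rewrite -[RHS]kgE e addr0.
  by rewrite -(fm y); elim: m {fm} => [//|m IH]; rewrite iterSr /= fy.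
case/eqP: nx; move: (gl x); elim: l {gl} => [//|l IH] /= /kg; exact: IH.
Qed.

Lemma bij_sum M (I : Type) (r : seq I) (F : I -> {linear M -> M}) (h : {linear M -> M}) :
  indecomposable M -> finlen M -> bijective h ->
  (forall x, h x = \sum_(i <- r) F i x) -> exists i, bijective (F i).
Proof.
move=> indM flM; elim: r h => [|i r IH] h bh hE.
  case: indM => nz _; case: nz => x; apply: (bij_inj bh).
  by rewrite !hE !big_nil.
have lr : linear (fun x => \sum_(j <- r) F j x).
  move=> a x y; rewrite scaler_sumr -big_split; apply: eq_bigr => j _.
  exact: linearP.
have [|b|/IH] := @bij_addl M (F i) (mklin lr) h indM flM bh.
- by move=> x; rewrite hE big_cons.
- by exists i.
- exact.
Qed.

Definition finite_cover (P : rmodType L -> Prop) : Prop :=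
  exists (m : nat) (K : 'I_m -> rmodType L), forall M, P M -> exists i, iso_mod M (K i).

Lemma finite_cover0 (P : rmodType L -> Prop) : (forall M, ~ P M) -> finite_cover P.
Proof. by move=> nP; exists 0%N, (fun=> L^c^o : rmodType L) => M /nP. Qed.

Lemma finite_coverU (P Q R : rmodType L -> Prop) : finite_cover P -> finite_cover Q ->
  (forall M, R M -> P M \/ Q M) -> finite_cover R.
Proof.
move=> [m [K KP]] [n [K' KQ]] PQ.
exists (m + n)%N, (fun i => match split i with inl j => K j | inr j => K' j end) => M.
move=> /PQ[/KP[i iso]|/KQ[i iso]].
  by exists (lshift n i); rewrite (unsplitK (inl i)).
by exists (rshift m i); rewrite (unsplitK (inr i)).
Qed.

Lemma finite_cover_ex (T : finType) (P : T -> rmodType L -> Prop) :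
  (forall t, finite_cover (P t)) -> finite_cover (fun M => exists t, P t M).
Proof.
move=> fc; suff [m [K H]] : finite_cover (fun M => exists2 t, t \in enum T & P t M).
  by exists m, K => M [t Pt]; apply: H; exists t; rewrite ?mem_enum.
elim: (enum T) => [|t r IH]; first by apply: finite_cover0 => M [].
apply: (finite_coverU (fc t) IH) => M [u].
rewrite inE => /orP[/eqP->|ur Pu]; first by left.
by right; exists u.
Qed.

Definition retract M N : Prop :=
  exists (i : {linear M -> N}) (p : {linear N -> M}), bijective (p \o i).

(** Induction on the length bound. If [N] is A x B with both factors nonzero, the bijection of [M]
    through [N] is a sum of a map through [A] and one through [B], and locality makes one of them
    bijective. *)
Lemma finite_cover_retract N : finlen N ->
  finite_cover (fun M => [/\ finlen M, indecomposable M & retract M N]).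
Proof.
move=> [l]; elim: l N => [|l IH] N bN.
  apply: finite_cover0 => M [_ [nz _] [i [p bij]]]; case: nz => x.
  have N0 y : y = 0 :> N.
    have [len lenP bnd] := bN; have sT : submod (fun _ : N => True) by [].
    have [_ h] := lenP _ _ (submod_eq0 N) sT (fun _ _ => I).
    by apply: h => //; rewrite (leq_trans (bnd _ sT)).
  by apply: (bij_inj bij); rewrite /= (N0 (i x)) (N0 (i 0)).
have [indN|nindN] := pselect (indecomposable N).
  exists 1%N, (fun=> N) => M [_ [nz _] [i [p bij]]]; exists ord0.
  exact: (indecomposable_retract nz indN bij).
have [zN|nzN] := pselect (zero_mod N).
  apply: finite_cover0 => M [_ [nz _] [i [p bij]]]; case: nz => x.
  by apply: (bij_inj bij); rewrite /= (zN (i x)) (zN (i 0)).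
have [A [B [iso nA nB]]] : exists A B : rmodType L,
    [/\ iso_mod N (A * B)%type, ~ zero_mod A & ~ zero_mod B].
  apply: contrapT => nAB; apply: nindN; split=> // A B iso.
  by apply: contrapT => /not_orP[nA nB]; apply: nAB; exists A, B.
have [f bf] := iso; have [g fK gK] := linear_bij_inv bf.
have ljA : linear (fun x : A => g (x, 0)).
  by move=> a x y; rewrite -linearP; congr (g _); congr (_, _) => /=; rewrite scaler0 addr0.
have ljB : linear (fun x : B => g (0, x)).
  by move=> a x y; rewrite -linearP; congr (g _); congr (_, _) => /=; rewrite scaler0 addr0.
have /existsNP[a0 na0] := nA; have /existsNP[b0 nb0] := nB.
have bA : bounded_length l A.
  apply: (bounded_length_proper (f := mklin ljA) _ _ bN).
    by move=> x y /= /(can_inj gK)[].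
  by exists (g (0, b0)) => x /= /(can_inj gK)[_ /esym].
have bB : bounded_length l B.
  apply: (bounded_length_proper (f := mklin ljB) _ _ bN).
    by move=> x y /= /(can_inj gK)[].
  by exists (g (a0, 0)) => x /= /(can_inj gK)[/esym].
apply: (finite_coverU (IH _ bA) (IH _ bB)) => M [flM indM [i [p bij]]].
have [|bi|bi] := @bij_addl M [the {linear _ -> _} of p \o mklin ljA \o fst \o f \o i]
    [the {linear _ -> _} of p \o mklin ljB \o snd \o f \o i] (p \o i) indM flM bij.
- move=> x /=; rewrite -!linearD; congr (p _).
  rewrite -[LHS]fK; congr (g _); rewrite [LHS]surjective_pairing.
  by congr (_, _); rewrite /= ?addr0 ?add0r.
- left; split=> //.
  by exists [the {linear _ -> _} of fst \o f \o i], [the {linear _ -> _} of p \o mklin ljA].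
- right; split=> //.
  by exists [the {linear _ -> _} of snd \o f \o i], [the {linear _ -> _} of p \o mklin ljB].
Qed.

End Indecomposable.

(** * Stable morphisms *)

Section CokernelFunctor.
Variables (X : preadditive) (A B : X) (f : pre_hom A B).

Lemma pre_comp0r (C D : X) (g : pre_hom C D) (E : X) : g \op (0 : pre_hom E C) = 0.
Proof. by apply: (addrI (g \op (0 : pre_hom E C))); rewrite -pre_compDr !addr0. Qed.

Lemma pre_comp0l (C D E : X) (g : pre_hom C D) : (0 : pre_hom D E) \op g = 0.
Proof. by apply: (addrI ((0 : pre_hom D E) \op g)); rewrite -pre_compDl !addr0. Qed.

Lemma pre_compBr (C D E : X) (g : pre_hom D E) (u v : pre_hom C D) :
  g \op (u - v) = (g \op u) - (g \op v).
Proof. by apply: (addIr (g \op v)); rewrite -pre_compDr !subrK. Qed.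

Lemma pre_compBl (C D E : X) (u v : pre_hom D E) (g : pre_hom C D) :
  (u - v) \op g = (u \op g) - (v \op g).
Proof. by apply: (addIr (v \op g)); rewrite -pre_compDl !subrK. Qed.

Definition image_pred (Y : X) : {pred pre_hom Y B} :=
  [pred u | `[< exists v : pre_hom Y A, u = f \op v >]].

Fact image_pred_closed Y : zmod_closed (@image_pred Y).
Proof.
split; first by apply/asboolP; exists 0; rewrite pre_comp0r.
move=> _ _ /asboolP[u ->] /asboolP[v ->]; apply/asboolP.
by exists (u - v); rewrite pre_compBr.
Qed.
HB.instance Definition _ Y :=
  GRing.isZmodClosed.Build (pre_hom Y B) (@image_pred Y) (image_pred_closed Y).

Definition coker_obj (Y : X) : zmodType := {ideal_quot (@image_pred Y)}.
Definition coker_pi (Y : X) (u : pre_hom Y B) : coker_obj Y := \pi u.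

Lemma coker_piP Y (u v : pre_hom Y B) :
  coker_pi u = coker_pi v <-> exists w : pre_hom Y A, u - v = f \op w.
Proof.
split=> [/eqP|h]; first by rewrite -Quotient.idealrBE => /asboolP.
by apply/eqP; rewrite -Quotient.idealrBE; apply/asboolP.
Qed.

Lemma coker_piD Y (u v : pre_hom Y B) : coker_pi (u + v) = coker_pi u + coker_pi v.
Proof. exact: raddfD. Qed.

Lemma coker_pi_ind Y (Q : coker_obj Y -> Prop) : (forall u, Q (coker_pi u)) -> forall q, Q q.
Proof. by move=> H q; rewrite -[q]reprK; apply: H. Qed.

Definition coker_map (Y Z : X) (h : pre_hom Y Z) (q : coker_obj Z) : coker_obj Y :=
  coker_pi (repr q \op h).

Lemma coker_map_pi (Y Z : X) (h : pre_hom Y Z) u :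
  coker_map h (coker_pi u) = coker_pi (u \op h).
Proof.
have /coker_piP[w wE] : coker_pi (repr (coker_pi u)) = coker_pi u by exact: reprK.
by apply/coker_piP; exists (w \op h); rewrite pre_compA -wE pre_compBl.
Qed.

Program Definition coker_functor : addfunctor X :=
  @AddFunctor X coker_obj coker_map _ _ _ _.
Next Obligation.
elim/coker_pi_ind: x => u; elim/coker_pi_ind: y => v.
by rewrite -coker_piD !coker_map_pi pre_compDl coker_piD.
Qed.
Next Obligation. by elim/coker_pi_ind: x => u; rewrite coker_map_pi pre_compf1. Qed.
Next Obligation. by elim/coker_pi_ind: x => u; rewrite !coker_map_pi pre_compA. Qed.
Next Obligation.
by elim/coker_pi_ind: x => u; rewrite !coker_map_pi pre_compDr coker_piD.
Qed.

Program Definition coker_proj : nattrans (representable B) coker_functor :=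
  @NatTrans X (representable B) coker_functor coker_pi _ _.
Next Obligation. exact: coker_piD. Qed.
Next Obligation. by rewrite coker_map_pi. Qed.

Program Definition rep_map : nattrans (representable A) (representable B) :=
  @NatTrans X (representable A) (representable B) (fun Y u => f \op u) _ _.
Next Obligation. exact: pre_compDr. Qed.
Next Obligation. exact: pre_compA. Qed.

Lemma coker_presented : finitely_presented coker_functor.
Proof.
exists B, A, rep_map, coker_proj => Y; split; first by elim/coker_pi_ind => u; exists u.
move=> u /=; have p0 : coker_pi (0 : pre_hom Y B) = 0 by exact: raddf0.
rewrite -p0; split=> [/coker_piP[w]|[w <-]]; first by rewrite subr0 => ->; exists w.
by apply/coker_piP; exists w; rewrite subr0.
Qed.

End CokernelFunctor.

Lemma representable_presented (X : preadditive) (B : X) :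
  finitely_presented (representable B).
Proof.
pose z : pre_hom B B := 0.
exists B, B, (rep_map z), (nt_id (representable B)) => Y.
split=> [x|u /=]; first by exists x.
split=> [->|[g <-]]; last by rewrite pre_comp0l.
by exists 0; rewrite pre_comp0l.
Qed.

(* The cokernel of [X(-, A) -> X(-, B)] is projective, so the projection onto
   it splits. *)
Lemma semisimple_regular (X : preadditive) : semisimple_abelian (mod_cat X) ->
  forall (A B : X) (f : pre_hom A B), exists g : pre_hom B A, f \op (g \op f) = f.
Proof.
move=> [_ proj] A B f.
pose F : mod_cat X := FpFunctor (coker_presented f).
pose P : mod_cat X := FpFunctor (representable_presented B).
have epi : @epic (mod_cat X) P F (coker_proj f).
  move=> Y u v /(congr1 (fun t : nattrans _ _ => nt_fun t)) uv.
  apply: nattrans_ext => C; elim/coker_pi_ind => w.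
  by have := congr1 (fun t => t C w) uv.
have [s0 sP] := proj F P F _ epi (nt_id _).
pose s : nattrans (coker_functor f) (representable B) := s0.
(* By Yoneda the splitting is given by an endomorphism [e] of [B]. That it splits the projection
   means id - e = f g for some g; as [f] becomes zero in the cokernel, e f = 0. Hence f g f = f. *)
pose e : pre_hom B B := s B (coker_pi f (pre_id B)).
have /(coker_piP f)[g gE] : coker_pi f (pre_id B) = coker_pi f e.
  by have := congr1 (fun t : nattrans (coker_functor f) (coker_functor f) =>
    nt_fun t B (coker_pi f (pre_id B))) sP.
exists g; rewrite pre_compA -gE pre_compBl pre_comp1f.
have -> : e \op f = s A (coker_pi f (pre_id B \op f)).
  by rewrite -coker_map_pi; exact/esym/(nt_nat s).
have -> : coker_pi f (pre_id B \op f) = coker_pi f 0.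
  by apply/coker_piP; exists (pre_id A); rewrite pre_comp1f subr0 pre_compf1.
have -> : coker_pi f (0 : pre_hom A B) = 0 by exact: raddf0.
suff -> : s A 0 = 0 by rewrite subr0.
by apply: (addrI (s A 0)); rewrite -nt_add !addr0.
Qed.

(** * Maps of finite rank *)

Section FiniteRank.
Variable A : pzRingType.
Implicit Types (M N K : lmodType A).

(** For linear maps this is factorization through a finitely generated free module, written without
    the intermediate module. *)
Definition finrank M N (f : M -> N) : Prop :=
  exists s : seq ({linear M -> A^o} * N), forall x, f x = \sum_(p <- s) (p.1 x : A) *: p.2.

Lemma eq_finrank M N (f g : M -> N) : (forall x, f x = g x) -> finrank f -> finrank g.
Proof. by move=> fg [s fs]; exists s => x; rewrite -fg. Qed.

Lemma finrank0 M N : finrank (fun _ : M => 0 : N).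
Proof. by exists [::] => x; rewrite big_nil. Qed.

Lemma finrankD M N (f g : M -> N) : finrank f -> finrank g -> finrank (fun x => f x + g x).
Proof. by move=> [s fs] [t gt]; exists (s ++ t) => x; rewrite big_cat /= fs gt. Qed.

Lemma finrank_compl M N K (g : {linear N -> K}) (f : M -> N) :
  finrank f -> finrank (fun x => g (f x)).
Proof.
move=> [s fs]; exists [seq (p.1, g p.2) | p <- s] => x; rewrite fs linear_sum big_map.
by apply: eq_bigr => p _; rewrite linearZ.
Qed.

Lemma finrank_compr M N K (g : N -> K) (f : {linear M -> N}) :
  finrank g -> finrank (fun x => g (f x)).
Proof.
move=> [s gs]; exists [seq ([the {linear M -> A^o} of (p : {linear N -> A^o} * K).1 \o f], p.2)
    | p <- s] => x.
by rewrite gs big_map.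
Qed.

Lemma finrankB M N (f g : M -> N) : finrank f -> finrank g -> finrank (fun x => f x - g x).
Proof.
move=> ff fg; apply: finrankD => //.
have lN : linear (fun x : N => - x).
  by move=> a x y; rewrite opprD scalerN.
exact: (finrank_compl (mklin lN)).
Qed.

Lemma finrankBl M N (f g : M -> N) : finrank (fun x => f x - g x) -> finrank g -> finrank f.
Proof.
by move=> fg gr; apply: (eq_finrank _ (finrankD fg gr)) => x; rewrite subrK.
Qed.

Lemma finrankBr M N (f g : M -> N) : finrank (fun x => f x - g x) -> finrank f -> finrank g.
Proof.
by move=> fg gr; apply: (eq_finrank _ (finrankB gr fg)) => x; rewrite opprB addrC subrK.
Qed.

(** Surjectivity of the dual map. For an embedding into a finitely generated projective it says that
    the embedding is a left projective approximation. *)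
Definition functionals_extend M N (e : {linear M -> N}) : Prop :=
  forall phi : {linear M -> A^o}, exists psi : {linear N -> A^o}, forall x, psi (e x) = phi x.

Lemma sum_rank1_linear M N (s : seq ({linear M -> A^o} * N)) :
  linear (fun x => \sum_(p <- s) (p.1 x : A) *: p.2).
Proof.
move=> a x y; rewrite scaler_sumr -big_split; apply: eq_bigr => p _.
by rewrite linearP scalerDl scalerA.
Qed.

Lemma finrank_extend M N K (e : {linear M -> N}) (f : M -> K) :
  functionals_extend e -> finrank f ->
  exists2 g : {linear N -> K}, finrank g & forall x, g (e x) = f x.
Proof.
move=> /choice[ext extP] [s fs].
pose t := [seq (ext p.1, p.2) | p <- s].
exists (mklin (sum_rank1_linear t)); first by exists t.
by move=> x; rewrite fs /= big_map; apply: eq_bigr => p _; rewrite /= extP.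
Qed.

End FiniteRank.

Section Projective.
Variable L : pzRingType.
Implicit Types (M N P : rmodType L).

(** Dual basis lemma: splitting the surjection from a free module yields the coordinate
    functionals. *)
Lemma fg_proj_finrank P : fg_proj P -> finrank (fun x : P => x).
Proof.
move=> [[n [s gen]] proj].
have le : linear (fun v : 'rV[L^c]_n => \sum_(i < n) v 0 i *: s i).
  move=> a v w; rewrite scaler_sumr -big_split; apply: eq_bigr => i _.
  by rewrite !mxE scalerDl scalerA.
have [|g gE] := proj _ _ (mklin le) _ [the {linear P -> P} of idfun].
  move=> x; have [a ->] := gen x; exists (\row_i a i) => /=.
  by apply: eq_bigr => i _; rewrite mxE.
have lg i : linear (fun x => g x 0 i : L^c^o).
  by move=> a x y; rewrite linearP !mxE.
exists [seq (mklin (lg i), s i) | i <- enum 'I_n] => x.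
by rewrite -[LHS]gE /= big_map big_enum.
Qed.

Lemma finrank_fg_proj P : finrank (fun x : P => x) -> fg_proj P.
Proof.
move=> [s sE]; split.
  exists (size s), (fun i => (tnth (in_tuple s) i).2) => x.
  exists (fun i => (tnth (in_tuple s) i).1 x).
  by rewrite {1}[x]sE big_tnth.
(* A section [r] that is not linear is enough, because only its values at the finitely many [f p.2]
   are used. *)
move=> M N e /choice[r rP] f.
pose t := [seq (p.1, r (f p.2)) | p <- s].
exists (mklin (sum_rank1_linear t)) => x.
rewrite /= big_map linear_sum [in RHS](sE x) linear_sum; apply: eq_bigr => p _ /=.
by rewrite !linearZ /= rP.
Qed.

Lemma factors_proj_finrank M N (f : homR M N) : factors_proj f -> finrank f.
Proof.
move=> [P [h [g [/fg_proj_finrank fP ->]]]].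
exact: (finrank_compl h (finrank_compr g fP)).
Qed.

(** Translates regularity in the stable category into a statement on actual linear maps. *)
Lemma stable_regular M N (f : {linear M -> N}) :
  semisimple_abelian (mod_cat (stable_gprj L)) ->
  gorenstein_projective M -> gorenstein_projective N ->
  exists g : {linear N -> M}, finrank (fun x => f (g (f x)) - f x).
Proof.
move=> ss gM gN.
have [g] := semisimple_regular ss
  (stable_pi (f : homR M N) : @pre_hom (stable_gprj L) (Gprj gM) (Gprj gN)).
elim/stable_pi_ind: g => g /=; rewrite !stable_comp_pi => /stable_piP fgf.
by exists g; apply: eq_finrank (factors_proj_finrank fgf).
Qed.

Definition embedded_syzygy (C : complex L) (i : int) M (u : {linear M -> C i}) : Prop :=
  injective u /\ forall x, cx_d C i x = 0 <-> exists m, u m = x.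

(** By acyclicity [M] is the image of the preceding differential. Pulling [phi] back along it gives
    a cocycle of the dual complex, and a functional bounding this cocycle extends [phi]. *)
Lemma syzygy_functionals_extend (C : complex L) (i : int) M (u : {linear M -> C i}) :
  acyclic C -> dual_acyclic C -> embedded_syzygy u -> functionals_extend u.
Proof.
move=> ac dac; have [j ij] : exists j : int, i = j + 1 + 1 by exists (i - 1 - 1); rewrite !subrK.
subst i => -[uI uK] phi.
have du x : exists m, u m = cx_d C (j + 1) x by apply/uK; apply: cx_dd.
have [r rE] := choice du.
have lr : linear (fun x => phi (r x)).
  move=> a x y; rewrite -linearP; congr (phi _); apply: uI.
  by rewrite linearP !rE linearP.
have [|psi psiP] := dac j (mklin lr).
  move=> x /=; rewrite -[RHS](linear0 phi); congr (phi _); apply: uI.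
  by rewrite rE cx_dd linear0.
exists psi => m; have [x xE] := ac (j + 1) (u m) ((uK (u m)).2 (ex_intro _ m erefl)).
rewrite -xE -psiP /=; congr (phi _); apply: uI.
by rewrite rE.
Qed.

Lemma gorenstein_embedding M : gorenstein_projective M ->
  exists (P : rmodType L) (u : {linear M -> P}),
    [/\ injective u, fg_proj P & functionals_extend u].
Proof.
move=> [_ [C [fpC ac dac [i [u su]]]]]; exists (C i), u; split=> //; first by case: su.
exact: (syzygy_functionals_extend ac dac su).
Qed.

End Projective.

(** * Generators of the stable category *)

Section CentralMorphism.
Variables (R : comPzRingType) (L : pzRingType) (phi : {rmorphism R -> L}).
Hypothesis phiC : forall r x, phi r * x = x * phi r.

Lemma converse_morphism : exists psi : {rmorphism R -> L^c}, forall r, psi r = phi r.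
Proof.
have phiB : zmod_morphism (phi : R -> L^c) by move=> x y; exact: (rmorphB phi).
have phiM : monoid_morphism (phi : R -> L^c).
  split; first exact: (rmorph1 phi).
  by move=> x y; rewrite (rmorphM phi) phiC.
pose psi : {rmorphism R -> L^c} := HB.pack (phi : R -> L^c)
  (GRing.isZmodMorphism.Build R L^c (phi : R -> L^c) phiB)
  (GRing.isMonoidMorphism.Build R L^c (phi : R -> L^c) phiM).
by exists psi.
Qed.
End CentralMorphism.

Lemma artin_algebra_converse (L : pzRingType) : artin_algebra L ->
  exists (R : comPzRingType) (phi : {rmorphism R -> L^c}) (n : nat) (s : 'I_n -> L^c),
    artinian R /\ forall x, exists a : 'I_n -> R, x = \sum_(i < n) phi (a i) * s i.
Proof.
move=> [R [phi [artR phiC [n [s gen]]]]].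
have [psi psiE] := converse_morphism phiC.
exists R, psi, n, s; split=> // x; have [a ->] := gen x; exists a.
by apply: eq_bigr => i _; rewrite phiC psiE.
Qed.

Lemma artin_algebra_filtered (L : pzRingType) : artin_algebra L ->
  filtered (@maximal_left_ideal L^c) (fun _ : L^c^o => True).
Proof.
move=> /artin_algebra_converse[R [phi [n [s [artR gen]]]]].
apply: (fg_filtered_algebra (phi := phi) (s := s) artR) => U U0 UD UZ Us x.
have [a ->] := gen x; elim/big_ind: _ => // i _; exact: UZ.
Qed.

Section Generation.
Variable L : pzRingType.
Hypothesis ss : semisimple_abelian (mod_cat (stable_gprj L)).

(* A finite rank map into U + A y / U = A / I lifts to A y, so it may be
   subtracted, leaving a map into U. *)
Lemma finrank_step (X G : rmodType L) (U : X -> Prop) (y : X) (I : L^c -> Prop)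
    (sU : submod U) (mI : maximal_left_ideal I) (g : {linear G -> quotmod mI.1})
    (s e : {linear X -> X}) :
  (forall c, I c -> U (c *: y)) -> ~ U y ->
  (forall f : {linear X -> quotmod mI.1},
     exists h : {linear X -> G}, forall x, f x = g (h x)) ->
  (forall u : {linear X -> G}, finrank (fun x => u (e x))) ->
  (forall x, exists c, U (s x - c *: y)) ->
  exists2 t : {linear X -> X}, (forall x, U (t x)) & finrank (fun x => s (e x) - t x).
Proof.
move=> Iy nUy gap ue /choice[c cP].
have UI b : U (b *: y) -> I b.
  move=> Ub; apply: contrapT => /(mI.2)[d Id]; apply: nUy.
  have -> : y = (1 - d * b) *: y + d *: (b *: y).
    by rewrite scalerBl scale1r scalerA subrK.
  by apply: submodD => //; [apply: Iy | apply: submodZ].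
pose q x := quotmod_pi mI.1 (c x).
have lq : linear q.
  move=> a x x'; rewrite /q -linearP; apply/quotm_piP/UI.
  have -> : (c (a *: x + x') - (a *: (c x : L^c^o) + c x')) *: y =
      (a *: (s x - c x *: y) + (s x' - c x' *: y)) - (s (a *: x + x') - c (a *: x + x') *: y).
    rewrite linearP scalerBl scalerDl scalerBr addrACA opprB [RHS]addrC addrA subrK.
    by rewrite -scalerA opprD.
  by apply: submodB => //; apply: submodD => //; apply: submodZ.
have [h hE] := gap (mklin lq).
have [r rE] := ue h.
have [d dE] := choice (fun p : {linear X -> L^c^o} * G => quotm_pi_surj (g p.2)).
(* The ring element [d p] represents the image of [p.2] in L / I, so the sum over [k] agrees with c
   (e x) y modulo [U]. *)
pose k := [seq (p.1, d p *: y) | p : {linear X -> L^c^o} * G <- r].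
have lt : linear (fun x => s (e x) - \sum_(p <- k) (p.1 x : L^c) *: p.2).
  by move=> a x x1; rewrite (sum_rank1_linear k) !linearP scalerBr /= scalerN addrACA.
exists (mklin lt); last first.
  by exists k => x; rewrite /= opprB addrC subrK.
move=> x /=; rewrite big_map.
have -> : \sum_(p <- r) (p.1 x : L^c) *: (d p *: y) = (\sum_(p <- r) (p.1 x : L^c) * d p) *: y.
  by rewrite scaler_suml; apply: eq_bigr => p _; rewrite scalerA.
have /quotm_piP/Iy : quotm_pi mI.1 (c (e x)) =
    quotm_pi mI.1 (\sum_(p <- r) (p.1 x : L^c) * d p).
  rewrite (hE (e x) : quotm_pi mI.1 (c (e x)) = _) rE linear_sum.
  rewrite -[RHS]/(quotmod_pi mI.1 _) linear_sum; apply: eq_bigr => p _.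
  by rewrite linearZ /= -dE; exact: (quotm_scale_pi mI.1).
rewrite scalerBl => Ud; have := submodD sU (cP (e x)) Ud.
by rewrite addrA subrK.
Qed.

(** With [k] a quasi-inverse of [f] and e = k f, the maps f e^m and [f] agree modulo finite rank for
    every m. So it suffices that some power of [e] has finite rank. *)
Lemma generation (r : nat) (J : 'I_r -> L^c -> Prop) (mJ : forall i, maximal_left_ideal (J i))
    (G : 'I_r -> rmodType L) (g : forall i, {linear G i -> quotmod (mJ i).1}) :
  filtered (fun I => exists i, I = J i) (fun _ : L^c^o => True) ->
  (forall i, gorenstein_projective (G i)) ->
  (forall i X, gorenstein_projective X -> forall f : {linear X -> quotmod (mJ i).1},
     exists h : {linear X -> G i}, forall x, f x = g i (h x)) ->
  forall (X Y : rmodType L) (f : {linear X -> Y}),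
    gorenstein_projective X -> gorenstein_projective Y ->
    (forall i (v : {linear G i -> X}), finrank (fun x => f (v x))) -> finrank f.
Proof.
move=> fJ gG gap X Y f gX gY fv.
have [k fkf] := stable_regular f ss gX gY.
pose e : {linear X -> X} := [the {linear X -> X} of k \o f].
have ev i (v : {linear G i -> X}) : finrank (fun x => e (v x)).
  exact: (finrank_compl k (fv i v)).
(* The hypothesis concerns maps out of the [G i]. Regularity transfers it to maps into them: u e
   agrees with u (e w) u e, and e w has finite rank. *)
have ue i (u : {linear X -> G i}) : finrank (fun x => u (e x)).
  have [w uew] := stable_regular [the {linear X -> G i} of u \o e] ss gX (gG i).
  apply: finrankBr uew _.
  exact: (finrank_compl u (finrank_compr [the {linear X -> G i} of u \o e] (ev i w))).
suff [m em] : exists m, finrank (iter m e).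
  have fe m' : finrank (fun x => f (iter m' e x) - f x).
    elim: m' => [|m' IH]; first by apply: eq_finrank (finrank0 X Y) => x; rewrite subrr.
    apply: eq_finrank (finrankD (finrank_compr (liter e m') fkf) IH) => x /=.
    by rewrite addrA subrK.
  exact: finrankBr (fe m) (finrank_compl f em).
(* Induction along a series of [X], starting from the identity: each step spends one factor [e] to
   move [s] into the next smaller submodule, up to finite rank. *)
suff H (U : X -> Prop) : filtered (fun I => exists i, I = J i) U ->
    forall s : {linear X -> X}, (forall x, U (s x)) -> exists m, finrank (fun x => s (iter m e x)).
  by apply: (H _ (fg_filtered fJ gX.1) [the {linear X -> X} of idfun]).
elim=> [|{}U y I fU IH [i ->] Jy] s sU.
  by exists 0%N; apply: eq_finrank (finrank0 X X) => x; rewrite sU.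
have sub := filtered_submod fU.
have [Uy|nUy] := pselect (U y).
  apply: IH => x; have [c Uc] := sU x.
  by rewrite -(subrK (c *: y) (s x)); apply: (submodD sub) => //; apply: (submodZ sub).
have [t tU st] := finrank_step sub Jy nUy (gap i X gX) (ue i) sU.
have [m tm] := IH t tU; exists m.+1.
apply: finrankBl tm.
by apply: eq_finrank (finrank_compr (liter e m) st) => x.
Qed.

End Generation.

Lemma omegaG_generators (L : pzRingType) : omegaG_algebra L ->
  exists (r : nat) (G : 'I_r -> rmodType L),
    (forall i, gorenstein_projective (G i)) /\
    forall (X Y : rmodType L) (f : {linear X -> Y}),
      gorenstein_projective X -> gorenstein_projective Y ->
      (forall i (v : {linear G i -> X}), finrank (fun x => f (v x))) -> finrank f.
Proof.
move=> [art cf ss].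
have [r [J [mJ fJ]]] := filtered_finite (artin_algebra_filtered art).
have fgq i : fg_mod (quotmod (mJ i).1 : rmodType L).
  exists 1%N, (fun=> quotmod_pi (mJ i).1 1) => q; have [x <-] := quotm_pi_surj q.
  exists (fun=> x); rewrite big_ord1 -linearZ /=.
  by congr quotm_pi; apply/esym/mulr1.
have H i := cf _ (fgq i).
have [G HG] := choice H.
pose g i := sval (cid (HG i)).
have gP i := svalP (cid (HG i)).
exists r, G; split; first by move=> i; case: (gP i).
apply: (generation ss (mJ := mJ) (g := g) fJ) => i; first by case: (gP i).
by move=> X gX f; case: (gP i) => _; apply.
Qed.

(** * Lower triangular matrices *)

Section TrigCalculus.
Variables (n : nat) (L : pzRingType).
Notation T := (trig_ring n L).

Lemma trig_mx_lt (A : T) (i j : 'I_n) : (i < j)%N -> (A : 'M[L]_n) i j = 0.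
Proof. by case: A => A /= /is_trig_mxP; apply. Qed.

Lemma trig_eq (A B : T) : (forall i j, (A : 'M[L]_n) i j = (B : 'M[L]_n) i j) -> A = B.
Proof. by move=> AB; apply/val_inj/matrixP. Qed.

Lemma trig_mulE (A B : T) i j :
  ((A * B : T) : 'M[L]_n) i j = \sum_k (A : 'M[L]_n) i k * (B : 'M[L]_n) k j.
Proof. by rewrite -[LHS]/(((A : 'M[L]_n) *m (B : 'M[L]_n)) i j) mxE. Qed.

Lemma trig_addE (A B : T) i j :
  ((A + B : T) : 'M[L]_n) i j = (A : 'M[L]_n) i j + (B : 'M[L]_n) i j.
Proof. by rewrite -[LHS]/(((A : 'M[L]_n) + (B : 'M[L]_n)) i j) mxE. Qed.

Lemma trig_sumE (I : Type) (r : seq I) (F : I -> T) i j :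
  ((\sum_(k <- r) F k : T) : 'M[L]_n) i j = \sum_(k <- r) (F k : 'M[L]_n) i j.
Proof.
elim: r => [|k r IH]; first by rewrite !big_nil mxE.
by rewrite !big_cons trig_addE IH.
Qed.

Fact tE_subproof (i j : 'I_n) :
  \matrix_(p, q) ((p == i) && (q == j) && (j <= i)%N)%:R \in @trigmx n L.
Proof.
apply/is_trig_mxP => p q pq; rewrite mxE; case: eqP => //= <-; case: eqP => //= <-.
by rewrite leqNgt pq.
Qed.

(* Matrix units, set to 0 above the diagonal. *)
Definition tE (i j : 'I_n) : T := TrigRing (tE_subproof i j).

Lemma tE_mxE i j p q : (tE i j : 'M[L]_n) p q = ((p == i) && (q == j) && (j <= i)%N)%:R.
Proof. by rewrite mxE. Qed.

Fact tD_subproof (a : L) : (a%:M : 'M[L]_n) \in @trigmx n L.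
Proof. exact: scalar_mx_is_trig. Qed.

Definition tD (a : L) : T := TrigRing (tD_subproof a).

Lemma tD_mulE a (A : T) i j : ((tD a * A : T) : 'M[L]_n) i j = a * (A : 'M[L]_n) i j.
Proof.
rewrite trig_mulE (bigD1 i) //= big1 => [|k ki]; rewrite mxE; last first.
  by rewrite eq_sym (negPf ki) mul0r.
by rewrite eqxx addr0.
Qed.

Lemma mul_tDE a (A : T) i j : ((A * tD a : T) : 'M[L]_n) i j = (A : 'M[L]_n) i j * a.
Proof.
rewrite trig_mulE (bigD1 j) //= big1 => [|k ki]; rewrite mxE; last first.
  by rewrite (negPf ki) mulr0.
by rewrite eqxx addr0.
Qed.

Lemma mul_tEE (A : T) i j p q :
  ((A * tE i j : T) : 'M[L]_n) p q = (A : 'M[L]_n) p i * ((q == j) && (j <= i)%N)%:R.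
Proof.
rewrite trig_mulE (bigD1 i) //= big1 => [|k ki]; rewrite tE_mxE; last first.
  by rewrite (negPf ki) mulr0.
by rewrite eqxx addr0.
Qed.

Lemma tE_gt (i j : 'I_n) : (i < j)%N -> tE i j = 0.
Proof. by move=> ij; apply: trig_eq => p q; rewrite tE_mxE leqNgt ij andbF mxE. Qed.

Lemma tE_mul (i j l : 'I_n) : (j <= i)%N -> (l <= j)%N -> tE i j * tE j l = tE i l.
Proof.
move=> ji lj; apply: trig_eq => p q; rewrite mul_tEE !tE_mxE lj ji (leq_trans lj ji) !andbT.
by rewrite eqxx andbT -natrM mulnb.
Qed.

Lemma tE_mul0 (i j k l : 'I_n) : j != k -> tE i j * tE k l = 0.
Proof.
move=> jk; apply: trig_eq => p q; rewrite mul_tEE tE_mxE [k == j]eq_sym (negPf jk) mxE.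
by rewrite andbF mul0r.
Qed.

Lemma tD_tE a i j : tD a * tE i j = tE i j * tD a.
Proof.
by apply: trig_eq => p q; rewrite tD_mulE mul_tDE tE_mxE; case: (_ && _);
   rewrite ?mulr1 ?mul1r ?mulr0 ?mul0r.
Qed.

Lemma trig_decomp (A : T) : A = \sum_i \sum_j tD ((A : 'M[L]_n) i j) * tE i j.
Proof.
apply: trig_eq => p q; rewrite trig_sumE (bigD1 p) // [X in _ = _ + X]big1 => [|i ip].
  rewrite addr0 trig_sumE (bigD1 q) // [X in _ = _ + X]big1 => [|j jq].
    rewrite addr0 tD_mulE tE_mxE !eqxx /=.
    by case: leqP => [_|/trig_mx_lt->]; rewrite ?mulr1 ?mul0r.
  by rewrite tD_mulE tE_mxE [q == j]eq_sym (negPf jq) andbF mulr0.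
rewrite trig_sumE big1 // => j _.
by rewrite tD_mulE tE_mxE [p == i]eq_sym (negPf ip) mulr0.
Qed.

Lemma tD_zmod_morphism : zmod_morphism (tD : L^c -> T^c).
Proof.
move=> a b; apply: trig_eq => i j.
by rewrite -[RHS]/((val (tD a) - val (tD b)) i j) !mxE mulrnBl.
Qed.

Lemma tD_monoid_morphism : monoid_morphism (tD : L^c -> T^c).
Proof.
split; first exact/val_inj.
by move=> a b; apply: trig_eq => i j; rewrite tD_mulE !mxE mulrnAr.
Qed.

Definition Delta : {rmorphism L^c -> T^c} := HB.pack (tD : L^c -> T^c)
  (GRing.isZmodMorphism.Build L^c T^c (tD : L^c -> T^c) tD_zmod_morphism)
  (GRing.isMonoidMorphism.Build L^c T^c (tD : L^c -> T^c) tD_monoid_morphism).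

Lemma trig_filtered : artin_algebra L ->
  filtered (@maximal_left_ideal T^c) (fun _ : T^c^o => True).
Proof.
move=> /artin_algebra_converse[R [phi [m [s [artR gen]]]]].
apply: (fg_filtered_algebra (phi := [the {rmorphism R -> T^c} of Delta \o phi])
  (s := fun p : 'I_m * 'I_n * 'I_n => (tD (s p.1.1) * tE p.1.2 p.2 : T)) artR).
move=> U U0 UD UZ Us x; rewrite (trig_decomp x).
elim/big_ind: _ => // i _; elim/big_ind: _ => // j _.
have [a ->] := gen ((x : 'M[L]_n) i j).
have -> : tD (\sum_(k < m) phi (a k) * s k : L^c) = \sum_(k < m) Delta (phi (a k) * s k) :> T.
  exact: (raddf_sum Delta).
rewrite mulr_suml; elim/big_ind: _ => // k _.
have -> : Delta (phi (a k) * s k) = tD (s k) * tD (phi (a k)) :> T by exact: (rmorphM Delta).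
rewrite -mulrA tD_tE mulrA; exact: UZ (Us (k, i, j)).
Qed.

End TrigCalculus.

(** * Modules over lower triangular matrices as chains *)

Lemma fg_mod_fin (L : pzRingType) (M : rmodType L) (I : finType) (s : I -> M) :
  (forall x, exists a : I -> L^c, x = \sum_i a i *: s i) -> fg_mod M.
Proof.
move=> gen; exists #|I|, (s \o enum_val) => x; have [a ->] := gen x.
by exists (a \o enum_val); rewrite (reindex _ (onW_bij _ (@enum_val_bij I))).
Qed.

Section Levels.
Variables (n : nat) (L : pzRingType).
Notation T := (trig_ring n L).
Notation rD M := (restr M (Delta n L)).
Implicit Types (M N : rmodType T) (i j k l : 'I_n).

(** In right module notation this is x E_ij. It carries level i to level j and vanishes unless j <=
    i, so the chain runs from high indices down to level 0. *)
Definition mE M i j (x : M) : M := (tE L i j : T^c) *: x.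

Lemma tE_Delta i j (a : L^c) :
  (tE L i j : T^c) * Delta n L a = Delta n L a * (tE L i j : T^c).
Proof. exact: tD_tE. Qed.

Lemma mE_linear M i j : linear (mE i j : rD M -> rD M).
Proof.
move=> a x y; rewrite /mE scalerDr; congr (_ + _).
by rewrite !restrZE !scalerA tE_Delta.
Qed.

Lemma mE_mul M i j l (x : M) : (j <= i)%N -> (l <= j)%N -> mE j l (mE i j x) = mE i l x.
Proof.
by move=> ji lj; rewrite /mE scalerA; congr (_ *: _); apply: tE_mul.
Qed.

Lemma mE_mul0 M i j k l (x : M) : j != k -> mE k l (mE i j x) = 0.
Proof.
move=> jk; rewrite /mE scalerA.
by rewrite [_ * _](tE_mul0 L i l jk) scale0r.
Qed.

Lemma mE_gt M i j (x : M) : (i < j)%N -> mE i j x = 0.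
Proof. by move=> ij; rewrite /mE tE_gt // scale0r. Qed.

Lemma mE_id M i j (x : M) : mE j j (mE i j x) = mE i j x.
Proof.
have [ji|ij] := leqP j i; first exact: mE_mul.
by rewrite [mE i j x]mE_gt // /mE scaler0.
Qed.

Lemma linear_mE M N (f : {linear M -> N}) i j (x : M) : f (mE i j x) = mE i j (f x).
Proof. exact: linearZ. Qed.

Lemma trig_scaleE M (A : T) (x : M) :
  (A : T^c) *: x = \sum_i \sum_j ((A : 'M[L]_n) i j : L^c) *: (mE i j x : rD M).
Proof.
rewrite {1}(trig_decomp A) scaler_suml; apply: eq_bigr => i _.
rewrite scaler_suml; apply: eq_bigr => j _.
by rewrite restrZE /mE scalerA -tE_Delta.
Qed.

Lemma trig_linear M N (f : M -> N) :
  (forall x y, f (x + y) = f x + f y) ->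
  (forall (a : L^c) (x : M), f (Delta n L a *: x) = Delta n L a *: f x) ->
  (forall i j x, f (mE i j x) = mE i j (f x)) -> linear f.
Proof.
move=> fD fZ fE A x y; rewrite fD; congr (_ + _).
have f0 : f 0 = 0 by apply: (addrI (f 0)); rewrite -fD !addr0.
have fsum (I : finType) (F : I -> M) : f (\sum_k F k) = \sum_k f (F k).
  by elim/big_rec2: _ => // k u v _ <-; rewrite fD.
rewrite !trig_scaleE fsum; apply: eq_bigr => i _; rewrite fsum; apply: eq_bigr => j _.
by rewrite !restrZE fZ fE.
Qed.

Definition in_level M i (x : rD M) : Prop := mE i i (x : M) = x.

Lemma in_level_submod M i : submod (@in_level M i).
Proof.
split; first exact: scaler0.
  by move=> x y hx hy; rewrite /in_level /mE scalerDr -[X in X + _]/(mE i i x)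
    -[X in _ + X]/(mE i i y) hx hy.
move=> a x hx; have := mE_linear i i a (x : rD M) 0; rewrite !addr0 /in_level => ->.
by rewrite hx -[X in _ + X]/(mE i i (0 : M)) /mE scaler0 addr0.
Qed.

Definition level M i : rmodType L := subm (@in_level_submod M i).

Lemma levelP M i (x : level M i) : mE i i (val x : M) = val x.
Proof. exact: (@submP _ _ _ (@in_level_submod M i) x). Qed.

Definition mk_level M i j (x : M) : level M j := to_subm (@in_level_submod M j) (mE_id i j x).

Lemma mk_level_linear M i j : linear (mk_level i j : rD M -> level M j).
Proof. by move=> a x y; apply: val_inj; rewrite /= mE_linear. Qed.

Definition proj_level M i j : {linear rD M -> level M j} := mklin (@mk_level_linear M i j).

Definition level_incl M i : {linear level M i -> rD M} := subm_incl (@in_level_submod M i).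

Lemma proj_levelK M i (x : level M i) : proj_level M i i (val x : M) = x.
Proof. by apply: val_inj; rewrite /= levelP. Qed.

Lemma proj_level_scale M i (A : T^c) (x : M) :
  proj_level M i i (A *: x : M) = \sum_q (((A : T) : 'M[L]_n) q i : L^c) *: mk_level q i x.
Proof.
rewrite trig_scaleE linear_sum; apply: eq_bigr => q _.
rewrite linear_sum (eq_bigr (fun j => if j == i then
    (((A : T) : 'M[L]_n) q i : L^c) *: mk_level q i x else 0)).
  by rewrite -big_mkcond big_pred1_eq.
move=> j _; rewrite linearZ; case: eqP => [->|/eqP ij].
  by congr (_ *: _); apply: val_inj; rewrite /= mE_id.
have -> : proj_level M i i (mE q j x : M) = 0 by apply: val_inj; rewrite /= mE_mul0.
exact: scaler0.
Qed.

Definition trans M i j : {linear level M i -> level M j} :=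
  [the {linear level M i -> level M j} of proj_level M i j \o level_incl M i].

Lemma transE M i j (x : level M i) : val (trans M i j x) = mE i j (val x : M).
Proof. by []. Qed.

Lemma trans_id M i (x : level M i) : trans M i i x = x.
Proof. by apply: val_inj; rewrite transE levelP. Qed.

Lemma trans_trans M i j l (x : level M i) : (j <= i)%N -> (l <= j)%N ->
  trans M j l (trans M i j x) = trans M i l x.
Proof. by move=> ji lj; apply: val_inj; rewrite !transE mE_mul. Qed.

Lemma mE_level M i j l (x : level M i) : i != j -> mE j l (val x : M) = 0.
Proof. by move=> ij; rewrite -levelP mE_mul0. Qed.

Section LevelMap.
Variables (M N : rmodType T) (f : {linear M -> N}).

Lemma linear_restr : linear (f : rD M -> rD N).
Proof. by move=> a x y; rewrite linearP. Qed.

Lemma level_map_subproof i (x : level M i) : in_level i (f (val x) : rD N).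
Proof. by rewrite /in_level -linear_mE levelP. Qed.

Definition level_map i : {linear level M i -> level N i} :=
  corestr (in_level_submod N i)
    (f := [the {linear level M i -> rD N} of mklin linear_restr \o level_incl M i])
    (@level_map_subproof i).

Lemma level_mapE i x : val (level_map i x) = f (val x).
Proof. by []. Qed.

Lemma level_map_trans i j x : level_map j (trans M i j x) = trans N i j (level_map i x).
Proof. by apply: val_inj; rewrite level_mapE !transE linear_mE. Qed.

End LevelMap.

Lemma regularE (a : L^c) (u : regular_rmod L) : a *: u = (u : L) * (a : L).
Proof. by []. Qed.

Lemma trig_regularE (A : T^c) (t : regular_rmod T) : A *: t = (t : T) * (A : T).
Proof. by []. Qed.

Definition entry M (g : {linear M -> regular_rmod T}) k l (x : rD M) : L^c^o :=
  ((g (x : M) : T) : 'M[L]_n) k l.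

Lemma entry_linear M (g : {linear M -> regular_rmod T}) k l : linear (entry g k l).
Proof.
move=> a x y; rewrite /entry linearP.
rewrite -[LHS]/(trig_val ((Delta n L a *: g (x : M) : T) + (g (y : M) : T)) k l) trig_addE.
congr (_ + _).
by rewrite trig_regularE [RHS]regularE; exact: (@mul_tDE n L a).
Qed.

Lemma entry_mE M (g : {linear M -> regular_rmod T}) k l i j x :
  entry g k l (mE i j x) = (entry g k i x : L) * ((l == j) && (j <= i)%N)%:R :> L.
Proof. by rewrite /entry linear_mE /mE trig_regularE; exact: (mul_tEE (g (x : M) : T) i j k l). Qed.

Definition level_entry M (g : {linear M -> regular_rmod T}) k l :
    {linear level M l -> L^c^o} :=
  [the {linear level M l -> L^c^o} of mklin (entry_linear g k l) \o level_incl M l].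

Lemma level_entry_trans M (g : {linear M -> regular_rmod T}) k i j x : (j <= i)%N ->
  level_entry g k j (trans M i j x) = level_entry g k i x.
Proof.
move=> ji; rewrite -[LHS]/(entry g k j (mE i j (val x))) entry_mE eqxx ji.
by rewrite /= mulr1.
Qed.

(** A dual basis over the matrix ring becomes one of level i over [L]: the part in level i of p.2
    times p.1 x is the sum over q of p.2 E_qi times the entry (q, i) of p.1 x. *)
Definition level_basis M i (s : seq ({linear M -> regular_rmod T} * M)) :=
  [seq (p.1, q, mk_level q i p.2)
  | p : {linear M -> regular_rmod T} * M <- s, q <- enum 'I_n].

Lemma level_basisP M i (s : seq ({linear M -> regular_rmod T} * M)) :
  (forall x, x = \sum_(p <- s) (p.1 x : T^c) *: p.2) ->
  forall x : level M i,
    x = \sum_(p <- level_basis i s) (level_entry p.1.1 p.1.2 i x : L^c) *: p.2.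
Proof.
move=> sE x; rewrite /level_basis big_allpairs_dep -[LHS]proj_levelK {1}[val x]sE linear_sum.
by apply: eq_bigr => p _; rewrite big_enum proj_level_scale.
Qed.

Lemma level_finrank M i : finrank (fun x : M => x) -> finrank (fun x : level M i => x).
Proof.
move=> [s sE]; exists [seq (level_entry p.1.1 p.1.2 i, p.2) | p <- level_basis i s] => x.
by rewrite big_map; apply: level_basisP.
Qed.

(** The coordinate functionals of the level basis are row entries, which exist on all levels
    compatibly with the transition maps. Expanding [phi] in them extends it. *)
Lemma trans_extend_proj M i j : finrank (fun x : M => x) -> (j <= i)%N ->
  functionals_extend (trans M i j).
Proof.
move=> [s sE] ji phi.
pose t := [seq (level_entry p.1.1 p.1.2 j, phi p.2) | p <- level_basis i s].
exists (mklin (sum_rank1_linear t)) => x.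
rewrite -[LHS]/(\sum_(q <- t) (q.1 (trans M i j x) : L^c) *: q.2) big_map.
rewrite [in RHS](level_basisP sE x) linear_sum; apply: eq_bigr => p _.
by rewrite linearZ; congr (_ *: _); apply: level_entry_trans.
Qed.

Lemma level_fg M i : fg_mod M -> fg_mod (level M i).
Proof.
move=> [m [s gen]]; apply: (@fg_mod_fin _ _ _ (fun p : 'I_m * 'I_n => mk_level p.2 i (s p.1))).
move=> x; have [a aE] := gen (val x : M).
exists (fun p => ((a p.1 : T) : 'M[L]_n) p.2 i).
rewrite -[LHS]proj_levelK aE linear_sum; under eq_bigr do rewrite proj_level_scale.
exact: pair_bigA.
Qed.

End Levels.

(** * Gorenstein projective chains *)

Section LevelComplex.
Variables (n : nat) (L : pzRingType).
Notation T := (trig_ring n.+1 L).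
Notation rD M := (restr M (Delta n.+1 L)).
Implicit Types (M N : rmodType T) (i j k l : 'I_n.+1).
Variable C : complex T.

Lemma level_cx_dd i z (x : level (C z) i) :
  level_map (cx_d C (z + 1)) i (level_map (cx_d C z) i x) = 0.
Proof. by apply: val_inj; rewrite !level_mapE cx_dd. Qed.

Definition level_complex i : complex L :=
  @Complex L (fun z => level (C z) i) (fun z => level_map (cx_d C z) i) (@level_cx_dd i).

Lemma level_acyclic i : acyclic C -> acyclic (level_complex i).
Proof.
move=> ac z x dx; have [|y yE] := ac z (val x); first exact: (congr1 val dx).
exists (mk_level i i y); apply: val_inj.
by rewrite -[LHS]/(cx_d C z (mE i i y)) linear_mE yE levelP.
Qed.

(* Functionals on the largest level that vanish on the images of the levels t > k
   are the T-linear maps into the k-th row of T. *)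
Section Row.
Variables (M : rmodType T) (psi : {linear level M ord0 -> regular_rmod L}) (k : 'I_n.+1).

Definition row_coef t (x : M) : T := tD n.+1 (psi (mk_level t ord0 x) : L).

(** The t-th entry of row k evaluates [psi] on x E_t0. Entries with t > k have no place in a lower
    triangular matrix, whence the vanishing condition imposed on [psi]. *)
Definition row_map (x : M) : T := \sum_t row_coef t x * tE L k t.

Lemma row_coefP t (a : L^c) (x y : rD M) :
  row_coef t (a *: x + y) = row_coef t x * tD n.+1 (a : L) + row_coef t y.
Proof.
have lt : linear (fun x : rD M => psi (mk_level t ord0 x)).
  exact: (linearP [the {linear rD M -> _} of psi \o proj_level M t ord0]).
rewrite /row_coef lt regularE.
have := rmorphD (Delta n.+1 L) ((psi (mk_level t ord0 x) : L) * (a : L)) (psi (mk_level t ord0 y)).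
move=> E; apply: (etrans E); congr (_ + _).
exact: (rmorphM (Delta n.+1 L) a (psi (mk_level t ord0 x))).
Qed.

Lemma row_coef0 t : row_coef t 0 = 0.
Proof.
have := row_coefP t 1 0 0; rewrite scaler0 addr0 => /eqP.
by rewrite [tD _ _](rmorph1 (Delta n.+1 L)) mulr1 -subr_eq0 opprD addNKr oppr_eq0 => /eqP.
Qed.

Hypothesis psi0 : forall t (x : level M t), (k < t)%N -> psi (trans M t ord0 x) = 0.

Lemma row_coef_gt (t : 'I_n.+1) x : (k < t)%N -> row_coef t x = 0.
Proof.
move=> kt; rewrite /row_coef.
have -> : mk_level t ord0 x = trans M t ord0 (mk_level t t x).
  by apply: val_inj; rewrite transE /= mE_mul.
by rewrite psi0 // [tD _ _](raddf0 (Delta n.+1 L)).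
Qed.

Lemma row_map_linear : linear (row_map : M -> regular_rmod T).
Proof.
apply: trig_linear.
- move=> x y; rewrite /row_map -big_split; apply: eq_bigr => t _.
  have := row_coefP t 1 x y; rewrite scale1r => ->.
  by rewrite [tD _ _](rmorph1 (Delta n.+1 L)) mulr1 mulrDl.
- move=> a x; rewrite trig_regularE /row_map mulr_suml; apply: eq_bigr => t _.
  have := row_coefP t a x 0; rewrite addr0 row_coef0 addr0 restrZE => ->.
  by rewrite -!mulrA; congr (_ * _); apply: tD_tE.
- move=> i j x; rewrite [in RHS]/mE trig_regularE /row_map mulr_suml.
  have E t : row_coef t (mE i j x) * tE L k t =
      if t == j then row_coef t (mE i j x) * tE L k t else 0.
    case: eqP => // /eqP tj; rewrite /row_coef.
    have -> : mk_level t ord0 (mE i j x) = 0.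
      by apply: val_inj; rewrite /= mE_mul0 // eq_sym.
    by rewrite linear0 [tD _ _](raddf0 (Delta n.+1 L)) mul0r.
  have E' t : row_coef t x * tE L k t * tE L i j =
      if t == i then row_coef t x * tE L k t * tE L i j else 0.
    by case: eqP => // /eqP ti; rewrite -mulrA tE_mul0 // mulr0.
  rewrite (eq_bigr _ (fun t _ => E t)) -big_mkcond big_pred1_eq.
  rewrite (eq_bigr _ (fun t _ => E' t)) -big_mkcond big_pred1_eq.
  have [ij|ji] := ltnP i j.
    by rewrite (mE_gt _ ij) row_coef0 mul0r [tE L i j]tE_gt // mulr0.
  have -> : row_coef j (mE i j x) = row_coef i x.
    rewrite /row_coef; suff -> : mk_level j ord0 (mE i j x) = mk_level i ord0 x by [].
    by apply: val_inj; rewrite /= mE_mul.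
  (* For i > k the matrix unit E_ki is zero on the right, and [psi0] makes the left side zero
     too. *)
  have [ki|ik] := ltnP k i; first by rewrite row_coef_gt // !mul0r.
  by rewrite -mulrA tE_mul.
Qed.

Lemma row_map_entry (x : level M ord0) :
  entry (mklin row_map_linear) k ord0 (val x) = psi x.
Proof.
rewrite /entry -[LHS]/(trig_val (row_map (val x)) k ord0) /row_map trig_sumE.
rewrite (bigD1 ord0) // [X in _ + X = _]big1 => [|t t0].
  rewrite addr0 tD_mulE tE_mxE !eqxx /= mulr1; congr (psi _).
  by apply: val_inj; rewrite /= levelP.
by rewrite tD_mulE tE_mxE eq_sym (negPf t0) andbF mulr0.
Qed.

End Row.

(** Dual exactness over the matrix ring, applied to the row map of [psi]. The entry (k, 0) of the
    bounding map is [omega], and it kills the levels t > k because entries above the diagonal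
    vanish. *)
Lemma row_exact k z (psi : {linear level (C (z + 1)) ord0 -> regular_rmod L}) :
  dual_acyclic C ->
  (forall x, psi (level_map (cx_d C z) ord0 x) = 0) ->
  (forall t (x : level (C (z + 1)) t), (k < t)%N -> psi (trans _ t ord0 x) = 0) ->
  exists omega : {linear level (C (z + 1 + 1)) ord0 -> regular_rmod L},
    (forall x, psi x = omega (level_map (cx_d C (z + 1)) ord0 x)) /\
    forall t (x : level (C (z + 1 + 1)) t), (k < t)%N -> omega (trans _ t ord0 x) = 0.
Proof.
move=> dac psid psi0.
have [|g gE] := dac z (mklin (row_map_linear psi0)).
  move=> x; rewrite -[LHS]/(row_map psi k _) /row_map big1 // => t _; rewrite /row_coef.
  have -> : mk_level t ord0 (cx_d C z x) = level_map (cx_d C z) ord0 (mk_level t ord0 x).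
    by apply: val_inj; rewrite level_mapE /= linear_mE.
  by rewrite psid [tD _ _](raddf0 (Delta n.+1 L)) mul0r.
exists (level_entry g k ord0); split.
  move=> x; rewrite -(row_map_entry psi0) /entry.
  by rewrite gE.
move=> t x kt; rewrite level_entry_trans //.
exact: (trig_mx_lt (g (val x : C (z + 1 + 1)) : T) kt).
Qed.

(** An extension [psi] of the cocycle [phi] to level 0 need not be a cocycle. Its coboundary
    vanishes on the images of the levels t >= i, so it is also the coboundary of some [chi] that
    kills level i. Then psi - chi is a cocycle on level 0 which still extends [phi]. *)
Lemma level_dual_acyclic i : (forall z, fg_proj (C z)) -> dual_acyclic C ->
  dual_acyclic (level_complex i).
Proof.
move=> fp dac z phi phid; have [j ij] : exists j : int, z = j + 1 by exists (z - 1); rewrite subrK.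
subst z; have frk w := fg_proj_finrank (fp w).
have [psi psiP] := trans_extend_proj (frk _) (leq0n i : (ord0 <= i)%N) phi.
have [chi [psichi chi0]] : exists chi : {linear level (C (j + 1 + 1)) ord0 -> regular_rmod L},
    (forall x, psi (level_map (cx_d C (j + 1)) ord0 x) = chi (level_map (cx_d C (j + 1)) ord0 x)) /\
    forall x, chi (trans _ i ord0 x) = 0.
  have [i0|i_gt0] := posnP i.
    exists [the {linear _ -> _} of \0]; split=> // x /=.
    have e : i = ord0 by apply: val_inj.
    move: phid psiP; subst i => phid psiP.
    have := psiP (level_map (cx_d C (j + 1)) ord0 x); rewrite trans_id => e.
    by apply: (etrans e); apply: phid.
  (* Row i - 1, since t > i - 1 means t >= i. *)
  have ki : (i.-1 < n.+1)%N by rewrite (leq_ltn_trans (leq_pred i)).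
  have [||chi [chiE chi0]] := @row_exact (Ordinal ki) j
      [the {linear _ -> _} of psi \o level_map (cx_d C (j + 1)) ord0] dac.
  - move=> x; apply: (etrans (congr1 psi (level_cx_dd x))); exact: linear0.
  - move=> t x it; rewrite -[LHS]/(psi (level_map (cx_d C (j + 1)) ord0 _)) level_map_trans.
    rewrite -(@trans_trans _ _ _ t i) //; last by rewrite -(prednK i_gt0).
    by rewrite psiP -level_map_trans phid.
  exists chi; split; first exact: chiE.
  by move=> x; apply: chi0; rewrite /= prednK.
have lsub : linear (fun x => psi x - chi x).
  by move=> a x y; rewrite (linearP psi) (linearP chi) scalerBr opprD addrACA.
(* For the last row the vanishing condition is empty, so this is exactness of the full dual of level
   0. *)
have [||omega [omegaE _]] := @row_exact ord_max (j + 1) (mklin lsub) dac.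
- by move=> x; rewrite /= psichi subrr.
- by move=> t x; rewrite ltnNge leq_ord.
exists [the {linear _ -> _} of omega \o trans _ i ord0] => x.
rewrite -[RHS]/(omega (trans (C (j + 1 + 1 + 1)) i ord0
  (level_map (cx_d C (j + 1 + 1)) i x))) -level_map_trans -omegaE.
by rewrite -[RHS]/(psi _ - chi _) psiP chi0 subr0.
Qed.

Lemma level_syzygy i z M (u : {linear M -> C z}) :
  embedded_syzygy u ->
  @embedded_syzygy _ (level_complex i) z (level M i) (level_map u i).
Proof.
move=> [uI uK]; split.
  by move=> x y /(congr1 val); rewrite !level_mapE => /uI/val_inj.
move=> x; split=> [dx|[m <-]].
  have [m mE_] := (uK (val x)).1 (congr1 val dx).
  have mL : in_level i (m : rD M).
    by apply: uI; rewrite linear_mE mE_ levelP.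
  by exists (to_subm (in_level_submod M i) mL); apply: val_inj.
by apply: val_inj; rewrite -[LHS]/(cx_d C z (u (val m))); apply/uK; exists (val m).
Qed.

End LevelComplex.

Section LevelGorenstein.
Variables (n : nat) (L : pzRingType).
Notation T := (trig_ring n.+1 L).

Lemma level_gorenstein (M : rmodType T) (i : 'I_n.+1) :
  gorenstein_projective M -> gorenstein_projective (level M i).
Proof.
move=> [fgM [C [fp ac dac [z [u su]]]]]; split; first exact: level_fg.
exists (level_complex C i); split.
- by move=> w; apply/finrank_fg_proj/level_finrank/fg_proj_finrank.
- exact: level_acyclic.
- exact: level_dual_acyclic.
- by exists z, (level_map u i); apply: level_syzygy.
Qed.

(** The functional is extended first to the projective term containing the syzygy, then along the
    levels of that term, and finally restricted to level j of [M]. *)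
Lemma trans_extend (M : rmodType T) (i j : 'I_n.+1) :
  gorenstein_projective M -> (j <= i)%N -> functionals_extend (trans M i j).
Proof.
move=> [fgM [C [fp ac dac [z [u su]]]]] ji phi.
have [psi psiP] := syzygy_functionals_extend (@level_acyclic _ _ _ i ac)
  (@level_dual_acyclic _ _ _ i fp dac) (level_syzygy i su) phi.
have [chi chiP] := trans_extend_proj (fg_proj_finrank (fp z)) ji psi.
exists [the {linear _ -> _} of chi \o level_map u j] => x.
rewrite -[LHS]/(chi (level_map u j (trans M i j x))) level_map_trans.
by rewrite (chiP (level_map u i x)); apply: psiP.
Qed.

End LevelGorenstein.

(** * Chains of submodules of a fixed module *)

Section Rows.
Variables (n : nat) (L : pzRingType) (W : rmodType L).
Notation T := (trig_ring n.+1 L).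
Implicit Types (i j k s t : 'I_n.+1).

(** Row vectors with matrices acting from the right: the chain with [W] on every level and identity
    transitions. *)
Definition rows : Type := {ffun 'I_n.+1 -> W}.
HB.instance Definition _ := GRing.Zmodule.on rows.

Definition rows_scale (A : T^c) (w : rows) : rows :=
  [ffun t => \sum_s (((A : T) : 'M[L]_n.+1) s t : L^c) *: (w : {ffun 'I_n.+1 -> W}) s].

Fact rows_scaleA A B w : rows_scale A (rows_scale B w) = rows_scale (A * B) w.
Proof.
apply/ffunP => t; rewrite !ffunE.
under eq_bigr => s _ do rewrite ffunE scaler_sumr.
rewrite exchange_big; apply: eq_bigr => r _.
rewrite -[(A * B : T^c)]/((B : T) * (A : T)) trig_mulE scaler_suml.
by apply: eq_bigr => s _; rewrite scalerA.
Qed.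

Fact rows_scale1 : left_id 1 rows_scale.
Proof.
move=> w; apply/ffunP => t; rewrite ffunE (bigD1 t) //= big1 => [|s st].
  by rewrite mxE eqxx scale1r addr0.
by rewrite mxE (negPf st) scale0r.
Qed.

Fact rows_scaleDr : right_distributive rows_scale +%R.
Proof.
move=> A v w; apply/ffunP => t; rewrite !ffunE -big_split; apply: eq_bigr => s _.
rewrite ffunE; exact: scalerDr.
Qed.

Fact rows_scaleDl w : {morph rows_scale^~ w : A B / A + B}.
Proof.
move=> A B; apply/ffunP => t; rewrite !ffunE -big_split; apply: eq_bigr => s _.
rewrite -[(A + B : T^c)]/((A : T) + (B : T)) trig_addE; exact: scalerDl.
Qed.

HB.instance Definition _ := GRing.Zmodule_isLmodule.Build T^c rows
  rows_scaleA rows_scale1 rows_scaleDr rows_scaleDl.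

Definition coord (w : rows) t : W := (w : {ffun 'I_n.+1 -> W}) t.

Lemma coord_ext (v w : rows) : (forall t, coord v t = coord w t) -> v = w.
Proof. by move=> vw; apply/ffunP => t; apply: vw. Qed.

Lemma coordD (v w : rows) t : coord (v + w) t = coord v t + coord w t.
Proof. exact: ffunE. Qed.

Lemma coord0 t : coord 0 t = 0.
Proof. exact: ffunE. Qed.

Lemma coordZ (A : T^c) (w : rows) t :
  coord (A *: w) t = \sum_s (((A : T) : 'M[L]_n.+1) s t : L^c) *: coord w s.
Proof. exact: ffunE. Qed.

Lemma coord_Delta (a : L^c) (w : rows) t : coord (Delta n.+1 L a *: w) t = a *: coord w t.
Proof.
rewrite coordZ (bigD1 t) //= big1 => [|s st].
  by rewrite mxE eqxx addr0.
by rewrite mxE (negPf st) scale0r.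
Qed.

Lemma coord_mE i j (w : rows) t :
  coord (mE i j w) t = if (t == j) && (j <= i)%N then coord w i else 0.
Proof.
rewrite coordZ (bigD1 i) //= big1 => [|s si].
  by rewrite tE_mxE eqxx addr0; case: (_ && _); rewrite ?scale1r ?scale0r.
by rewrite tE_mxE (negPf si) scale0r.
Qed.

Lemma coord_sum (I : Type) (r : seq I) (F : I -> rows) t :
  coord (\sum_(k <- r) F k) t = \sum_(k <- r) coord (F k) t.
Proof.
elim: r => [|k r IH]; first by rewrite !big_nil coord0.
by rewrite !big_cons coordD IH.
Qed.

Lemma rows_fg : fg_mod W -> fg_mod (rows : rmodType T).
Proof.
move=> [m [s gen]].
(* Every position is reached from the last one, so vectors supported there generate, with
   coefficients in the last row of a matrix. *)
pose g q : rows := [ffun t => if t == ord_max then s q else 0].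
have gE q t : coord (g q) t = if t == ord_max then s q else 0 by exact: ffunE.
exists m, g => w; have [c cE] := choice (fun t => gen (coord w t)).
have aE q t : ((\sum_u tD n.+1 (c u q : L) * tE L ord_max u : T) : 'M[L]_n.+1) ord_max t = c t q.
  rewrite trig_sumE (bigD1 t) // [X in _ + X = _]big1 => [|u ut].
    by rewrite addr0 tD_mulE tE_mxE !eqxx leq_ord mulr1.
  by rewrite tD_mulE tE_mxE [t == u]eq_sym (negPf ut) andbF mulr0.
exists (fun q => \sum_t tD n.+1 (c t q : L) * tE L ord_max t : T).
apply: coord_ext => t; rewrite coord_sum {1}cE; apply: eq_bigr => q _.
rewrite coordZ (bigD1 ord_max) // [X in _ = _ + X]big1 => [|u ue].
  by rewrite addr0 gE eqxx aE.
by rewrite gE (negPf ue) scaler0.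
Qed.

Section Filtration.
Variable U : 'I_n.+1 -> W -> Prop.
Hypothesis sU : forall t, submod (U t).
Hypothesis decU : forall s t x, (t <= s)%N -> U s x -> U t x.

Definition in_rows (w : rows) : Prop := forall t, U t (coord w t).

Lemma in_rows_submod : submod in_rows.
Proof.
split; first by move=> t; rewrite coord0; apply: submod0.
  by move=> v w hv hw t; rewrite coordD; apply: submodD.
move=> A w hw t; rewrite coordZ; apply: submod_sum => // s _.
have [ts|st] := leqP t s; first by apply: submodZ => //; apply: (decU ts).
by rewrite trig_mx_lt // scale0r; apply: submod0.
Qed.

Definition rows_sub : rmodType T := subm in_rows_submod.

Section ToRows.
Variables (M : rmodType T) (rho : {linear level M ord0 -> W}).

(** The constant chain is coinduced from level 0: linear maps from [M] into it correspond to linear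
    maps from level 0 of [M] to [W]. *)
Definition to_rows (x : M) : rows := [ffun t => rho (mk_level t ord0 x)].

Lemma coord_to_rows x t : coord (to_rows x) t = rho (mk_level t ord0 x).
Proof. exact: ffunE. Qed.

Lemma to_rows_linear : linear to_rows.
Proof.
have lt t (a : L^c) (x y : restr M (Delta n.+1 L)) :
    rho (mk_level t ord0 (a *: x + y)) = a *: rho (mk_level t ord0 x) + rho (mk_level t ord0 y).
  exact: (linearP [the {linear restr M (Delta n.+1 L) -> _} of rho \o proj_level M t ord0]).
have l0 t : rho (mk_level t ord0 (0 : M)) = 0.
  have -> : mk_level t ord0 (0 : M) = 0 by apply: val_inj; rewrite /= /mE scaler0.
  exact: linear0.
apply: trig_linear.
- move=> x y; apply: coord_ext => t; rewrite coordD !coord_to_rows.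
  by have := lt t 1 x y; rewrite !scale1r.
- move=> a x; apply: coord_ext => t; rewrite coord_Delta !coord_to_rows.
  by have := lt t a x 0; rewrite !addr0 l0 addr0.
- move=> i j x; apply: coord_ext => t; rewrite coord_mE !coord_to_rows.
  case: eqP => [->|/eqP tj] /=.
    have [ji|ij] := leqP j i; last by rewrite mE_gt.
    by congr (rho _); apply: val_inj; rewrite /= mE_mul.
  have -> : mk_level t ord0 (mE i j x) = 0.
    by apply: val_inj; rewrite /= mE_mul0 // eq_sym.
  exact: linear0.
Qed.

Hypothesis rhoU : forall t (x : level M t), U t (rho (trans M t ord0 x)).

Lemma to_rows_sub x : in_rows (to_rows x).
Proof.
move=> t; rewrite coord_to_rows.
have -> : mk_level t ord0 x = trans M t ord0 (mk_level t t x).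
  by apply: val_inj; rewrite transE /= mE_mul.
exact: rhoU.
Qed.

Definition to_rows_map : {linear M -> rows_sub} :=
  corestr in_rows_submod (f := mklin to_rows_linear) to_rows_sub.
End ToRows.

Section FromRows.
Variables (M : rmodType T) (a : 'I_n.+1 -> W -> M).
Hypothesis aP : forall t (c : L^c) x y, U t x -> U t y ->
  a t (c *: x + y) = Delta n.+1 L c *: a t x + a t y.
Hypothesis a_level : forall t x, U t x -> mE t t (a t x) = a t x.
Hypothesis a_trans : forall s t x, (s <= t)%N -> U t x -> mE t s (a t x) = a s x.

(** The [a t] are plain functions on [W], constrained on [U t] only, which avoids families of maps
    between subtypes. *)
Definition from_rows (w : rows_sub) : M := \sum_t a t (coord (val w) t).

Let a0 t : a t 0 = 0.
Proof.
have U0 : U t 0 by apply: submod0.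
have := aP 1 U0 U0; rewrite scaler0 addr0 rmorph1 scale1r => /eqP.
by rewrite -subr_eq0 opprD addNKr oppr_eq0 => /eqP.
Qed.

Lemma from_rows_linear : linear from_rows.
Proof.
have inU (w : rows_sub) t : U t (coord (val w) t) by exact: (submP w).
apply: trig_linear.
- move=> v w; rewrite /from_rows -big_split; apply: eq_bigr => t _.
  have := aP 1 (inU v t) (inU w t); rewrite scale1r rmorph1 scale1r => E.
  by apply: (etrans _ E); rewrite -coordD.
- move=> c w; rewrite /from_rows scaler_sumr; apply: eq_bigr => t _.
  rewrite -[LHS]/(a t (coord (Delta n.+1 L c *: (val w : rows)) t)) coord_Delta.
  by have := aP c (inU w t) (submod0 (sU t)); rewrite !addr0 a0 addr0.
- move=> i j w; rewrite /from_rows [RHS]scaler_sumr.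
  have E t : a t (coord (val (mE i j w)) t) =
      if t == j then a j (if (j <= i)%N then coord (val w) i else 0) else 0.
    rewrite -[LHS]/(a t (coord (mE i j (val w : rows)) t)) coord_mE.
    by case: eqP => [->|] //=; rewrite a0.
  have E' t : mE i j (a t (coord (val w) t)) =
      if t == i then mE i j (a i (coord (val w) i)) else 0.
    case: eqP => [->//|/eqP ti]; rewrite -(a_level (inU w t)); exact: mE_mul0.
  rewrite (eq_bigr _ (fun t _ => E t)) -big_mkcond big_pred1_eq.
  rewrite (eq_bigr _ (fun t _ => E' t)) -big_mkcond big_pred1_eq.
  case: leqP => [ji|ij]; last by rewrite a0 mE_gt.
  by rewrite a_trans.
Qed.

Definition from_rows_map : {linear rows_sub -> M} := mklin from_rows_linear.

Lemma from_to_rows (rho : {linear level M ord0 -> W})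
    (rhoU : forall t (x : level M t), U t (rho (trans M t ord0 x))) k (x : level M k) :
  from_rows_map (to_rows_map rhoU (val x)) = a k (rho (trans M k ord0 x)).
Proof.
rewrite -[LHS]/(\sum_t a t (coord (to_rows rho (val x)) t)).
have E t : a t (coord (to_rows rho (val x)) t) =
    if t == k then a k (rho (trans M k ord0 x)) else 0.
  rewrite coord_to_rows; case: eqP => [->|/eqP tk].
    by congr (a _ (rho _)); apply: val_inj.
  have -> : mk_level t ord0 (val x : M) = 0.
    by apply: val_inj; rewrite /= mE_level // eq_sym.
  by rewrite linear0 a0.
by rewrite (eq_bigr _ (fun t _ => E t)) -big_mkcond big_pred1_eq.
Qed.

End FromRows.
End Filtration.
End Rows.

(** * Interval modules *)

Section Interval.
Variables (n : nat) (L : pzRingType) (G P : rmodType L) (iota : {linear G -> P}).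
Notation T := (trig_ring n.+1 L).
Variables k j : 'I_n.+1.

Definition interval_pred (t : 'I_n.+1) (p : P) : Prop :=
  if (k < t)%N then p = 0 else (j <= t)%N -> lin_image iota (fun=> True) p.

Lemma interval_submod t : submod (interval_pred t).
Proof.
have [_ hD hZ] : submod (lin_image iota (fun=> True)) by apply: submod_image.
rewrite /interval_pred; case: ltnP => _; first exact: submod_eq0.
split; first by move=> _; exists 0; rewrite ?linear0.
  by move=> x y hx hy jt; apply: hD; [apply: hx | apply: hy].
by move=> a x hx jt; apply/hZ/hx.
Qed.

Lemma interval_dec (s t : 'I_n.+1) x : (t <= s)%N -> interval_pred s x -> interval_pred t x.
Proof.
rewrite /interval_pred => ts; case: (ltnP k t) => [kt|tk].
  by rewrite (leq_trans kt ts).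
case: ltnP => [ks -> _|sk h jt]; first by exists 0; rewrite ?linear0.
exact: h (leq_trans jt ts).
Qed.

(* The rows with entries 0 (t > k), in the image of G (j <= t <= k) and in P
   (t < j). *)
Definition interval : rmodType T := rows_sub interval_submod interval_dec.

(** The map into the interval is induced by [rho]; by [h0] and [rhoE] each level lands in the
    prescribed submodule of [P]. The map out is glued from [v] on the levels j to k and [sigma]
    below j, which match by [sigE]. *)
Lemma interval_factor (M : rmodType T) (v : {linear G -> level M k})
    (h : {linear level M j -> G}) (rho : {linear level M ord0 -> P})
    (sigma : forall t : 'I_n.+1, {linear P -> level M t}) :
  injective iota -> (j <= k)%N ->
  (forall t (x : level M t), (k < t)%N -> h (trans M t j x) = 0) ->
  (forall x, rho (trans M j ord0 x) = iota (h x)) ->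
  (forall (t : 'I_n.+1) g, (t < j)%N -> sigma t (iota g) = trans M k t (v g)) ->
  (forall (s t : 'I_n.+1) p, (s <= t)%N -> (t < j)%N -> trans M t s (sigma t p) = sigma s p) ->
  exists (beta : {linear M -> interval}) (alpha : {linear interval -> M}),
    forall x : level M k, alpha (beta (val x)) = val (v (h (trans M k j x))).
Proof.
move=> iI jk h0 rhoE sigE sigT.
(* An inverse of [iota] on its image, with default value 0 elsewhere. *)
have [p|r rP] := @choice _ _ (fun p g => lin_image iota (fun=> True) p -> iota g = p).
  have [[g _ ->]|np] := pselect (lin_image iota (fun=> True) p); first by exists g.
  by exists 0.
have rhoU t (x : level M t) : interval_pred t (rho (trans M t ord0 x)).
  have rhoj : (j <= t)%N -> rho (trans M t ord0 x) = iota (h (trans M t j x)).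
    by move=> jt; rewrite -rhoE trans_trans.
  rewrite /interval_pred; case: ltnP => [kt|tk jt]; last first.
    by exists (h (trans M t j x)); rewrite ?rhoj.
  by rewrite rhoj ?h0 ?linear0 // (leq_trans jk (ltnW kt)).
pose a (t : 'I_n.+1) (p : P) : M :=
  if (t < j)%N then val (sigma t p) else
  if (t <= k)%N then val (trans M k t (v (r p))) else 0.
have riota g : r (iota g) = g by apply: iI; apply: rP; exists g.
have vL (t : 'I_n.+1) (Q : rmodType L) (f : {linear Q -> level M t}) (c : L^c) (x y : Q) :
    val (f (c *: x + y)) = Delta n.+1 L c *: (val (f x) : M) + val (f y) :> M.
  by rewrite linearP.
have aP t (c : L^c) x y : interval_pred t x -> interval_pred t y ->
    a t (c *: x + y) = Delta n.+1 L c *: a t x + a t y.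
  rewrite /a /interval_pred; case: (ltnP t j) => [_ _ _|jt]; first exact: vL.
  case: (ltnP k t) => [kt _ _|tk /(_ isT)[g _ ->] /(_ isT)[g' _ ->]].
    by rewrite scaler0 addr0.
  rewrite -linearP !riota.
  exact: (vL t G [the {linear G -> level M t} of trans M k t \o v]).
have a_level t x : interval_pred t x -> mE t t (a t x) = a t x.
  rewrite /a /interval_pred; case: (ltnP t j) => [_ _|jt]; first exact: levelP.
  case: (ltnP k t) => [_ _|_ _]; first exact: scaler0.
  exact: levelP.
have a_trans (s t : 'I_n.+1) x : (s <= t)%N -> interval_pred t x -> mE t s (a t x) = a s x.
  rewrite /a /interval_pred => st; case: (ltnP t j) => [tj _|jt].
    by rewrite (leq_ltn_trans st tj) -(sigT s t x st tj).
  case: (ltnP k t) => [kt ->|tk /(_ isT)[g _ ->]].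
    rewrite linear0 [mE _ _ _]scaler0; case: ifP => // _; case: leqP => // sk.
    have -> : r 0 = 0 by rewrite -(riota 0) linear0.
    by rewrite !linear0.
  rewrite riota -[LHS]/(val (trans M t s (trans M k t (v g)))) trans_trans //.
  by case: (ltnP s j) => [sj|js]; rewrite ?sigE // (leq_trans st tk).
exists (to_rows_map interval_submod interval_dec rhoU).
exists (from_rows_map interval_submod interval_dec aP a_level a_trans) => x.
have kj : (k < j)%N = false by rewrite ltnNge jk.
rewrite from_to_rows /a kj leqnn trans_id.
by rewrite -[X in rho X](trans_trans (j := j)) // rhoE riota.
Qed.

Lemma interval_finlen : artin_algebra L -> fg_mod P -> finlen interval.
Proof.
move=> art fgP; apply: (finlen_inj (f := subm_incl (in_rows_submod interval_submod interval_dec))).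
  exact: val_inj.
apply: filtered_finlen; apply: fg_filtered (trig_filtered n.+1 art) _.
exact: rows_fg fgP.
Qed.

End Interval.

(** * Finiteness *)

Section Main.
Variables (n : nat) (L : pzRingType).
Notation T := (trig_ring n.+1 L).
Hypothesis art : artin_algebra L.

Lemma indecomposable_level (M : rmodType T) : indecomposable M ->
  exists k : 'I_n.+1, ~ zero_mod (level M k) /\
    forall t : 'I_n.+1, (k < t)%N -> zero_mod (level M t).
Proof.
move=> [nzM _].
pose Q m := [exists k : 'I_n.+1, (k == m :> nat) && ~~ `[< zero_mod (level M k) >]].
have Qb m : Q m -> (m <= n)%N by case/existsP => k /andP[/eqP<- _]; rewrite -ltnS.
have exQ : exists m, Q m.
  apply: contrapT => nQ; apply: nzM => x.
  have z k (y : level M k) : y = 0.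
    move: y; apply: contrapT => nz; apply: nQ; exists (k : nat); apply/existsP; exists k.
    by rewrite eqxx /=; apply/asboolP.
  rewrite -[x]scale1r trig_scaleE big1 // => i _; rewrite big1 // => j _.
  have -> : mE i j x = val (mk_level i j x) by [].
  by rewrite (z _ (mk_level i j x)); apply: scaler0.
have [m /existsP[k /andP[/eqP <- /asboolP nz]] maxm] := ex_maxnP exQ Qb.
exists k; split=> // t kt; apply: contrapT => nzt.
have : Q t by apply/existsP; exists t; rewrite eqxx /=; apply/asboolP.
by move/maxm; rewrite leqNgt kt.
Qed.

Lemma retract_of_factor (M N : rmodType T) (beta : {linear M -> N}) (alpha : {linear N -> M}) :
  gorenstein_projective M -> indecomposable M ->
  (forall m, ~ forall x, iter m (alpha \o beta) x = 0) -> retract M N.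
Proof.
move=> [fgM _] indM nil.
have flM : finlen M := filtered_finlen (fg_filtered (trig_filtered n.+1 art) fgM).
have [b|[m]] := @fitting _ M [the {linear M -> M} of alpha \o beta] indM flM.
  by exists beta, alpha.
by move/(nil m).
Qed.

Lemma level_iter (M : rmodType T) k (f : M -> M) (e : level M k -> level M k) m
    (x : level M k) :
  (forall y : level M k, f (val y) = val (e y)) -> iter m f (val x) = val (iter m e x).
Proof. by move=> fe; elim: m => // m IH; rewrite !iterS IH fe. Qed.

(** As [trans M k k] is the identity, all levels are projective. On the top nonzero level a dual
    basis writes the identity as a sum of rank one maps, each of which is the restriction of an
    endomorphism of [M] through the interval. Their sum is not nilpotent, hence bijective, and by
    locality so is one summand. *)
Lemma projective_levels (M : rmodType T) :
  gorenstein_projective M -> indecomposable M ->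
  (forall k : 'I_n.+1, finrank (trans M k k)) ->
  exists k : 'I_n.+1,
    retract M (interval [the {linear regular_rmod L -> regular_rmod L} of idfun] k ord0).
Proof.
move=> gM indM fr; have [k [nzk zt]] := indecomposable_level indM.
have [s sE] := fr k; exists k; set N := interval _ _ _.
have step (p : {linear level M k -> regular_rmod L} * level M k) :
    exists q : {linear M -> N} * {linear N -> M},
      forall x : level M k, q.2 (q.1 (val x)) = val ((p.1 x : L^c) *: p.2).
  have [h hE] := trans_extend gM (leq0n k : (ord0 <= k)%N) p.1.
  have lv : linear (fun a : regular_rmod L => (a : L^c) *: p.2).
    by move=> a x y; rewrite scalerDl scalerA.
  (* With j = 0 there are no levels below j, so [sigma] may be zero; the extension of [p.1] to level
     0 serves both as [h] and as [rho]. *)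
  have [||||||beta [alpha ab]] := @interval_factor n L _ _
    [the {linear regular_rmod L -> _} of idfun] k ord0 M (mklin lv) h h
    (fun t => [the {linear _ -> level M t} of \0]) => //.
  - by move=> t x kt; rewrite (zt t kt x) !linear0.
  - by move=> x; rewrite trans_id.
  by exists (beta, alpha) => x; rewrite ab hE.
have [q qP] := choice step.
have lS : linear (fun x : M => \sum_(p <- s) (q p).2 ((q p).1 x)).
  move=> a x y; rewrite scaler_sumr -big_split; apply: eq_bigr => p _.
  by rewrite !linearP.
have flM : finlen M := filtered_finlen (fg_filtered (trig_filtered n.+1 art) gM.1).
have SE (x : level M k) : mklin lS (val x) = val x :> M.
  rewrite -[LHS]/(\sum_(p <- s) (q p).2 ((q p).1 (val x))) -[in RHS](trans_id x) sE.
  rewrite -[RHS]/(level_incl M k _) linear_sum; apply: eq_bigr => p _.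
  exact: qP.
have [b|[m mz]] := fitting (mklin lS) indM flM.
  have [p bp] := bij_sum (F := fun p => [the {linear M -> M} of (q p).2 \o (q p).1]) indM flM b
    (fun x => erefl).
  by exists (q p).1, (q p).2.
case: nzk => x; apply: val_inj; rewrite -[RHS](mz (val x)).
by elim: m {mz} => // m IH; rewrite iterSr SE.
Qed.

Hypothesis ss : semisimple_abelian (mod_cat (stable_gprj L)).

Lemma nonprojective_levels (r : nat) (G P : 'I_r -> rmodType L)
    (iota : forall i, {linear G i -> P i}) (M : rmodType T) :
  (forall i, gorenstein_projective (G i)) ->
  (forall i, [/\ injective (iota i), fg_proj (P i) & functionals_extend (iota i)]) ->
  (forall (X Y : rmodType L) (f : {linear X -> Y}),
      gorenstein_projective X -> gorenstein_projective Y ->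
      (forall i (v : {linear G i -> X}), finrank (fun x => f (v x))) -> finrank f) ->
  gorenstein_projective M -> indecomposable M ->
  ~ (forall k : 'I_n.+1, finrank (trans M k k)) ->
  exists i (k j : 'I_n.+1), retract M (interval (iota i) k j).
Proof.
move=> gG iotaP gen gM indM nfr.
pose Q d := [exists k : 'I_n.+1, exists j : 'I_n.+1,
  [&& (j <= k)%N, (k - j)%N == d & ~~ `[< finrank (trans M k j) >]]].
have exQ : exists d, Q d.
  have /existsNP[k nk] := nfr; exists 0%N; apply/existsP; exists k; apply/existsP; exists k.
  by rewrite leqnn subnn eqxx; apply/asboolP.
have Qb d : Q d -> (d <= n)%N.
  case/existsP => k /existsP[j /and3P[_ /eqP<- _]].
  by rewrite (leq_trans (leq_subr _ _)) // -ltnS.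
have [d /existsP[k /existsP[j /and3P[jk /eqP dE /asboolP nkj]]] maxd] := ex_maxnP exQ Qb.
have frk (k' j' : 'I_n.+1) : (j' <= k')%N -> (k - j < k' - j')%N -> finrank (trans M k' j').
  move=> jk' lt; apply: contrapT => nf.
  have /maxd : Q (k' - j')%N.
    by apply/existsP; exists k'; apply/existsP; exists j'; rewrite jk' eqxx; apply/asboolP.
  by rewrite -dE leqNgt lt.
have gL i : gorenstein_projective (level M i) := level_gorenstein i gM.
have [i [v nfv]] : exists i (v : {linear G i -> level M k}), ~ finrank (fun x => trans M k j (v x)).
  apply: contrapT => nv; apply: nkj; apply: gen => // i v.
  by apply: contrapT => nf; apply: nv; exists i, v.
have [iI fpP iext] := iotaP i.
pose f := [the {linear G i -> level M j} of trans M k j \o v].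
have [h0 reg] := stable_regular f ss (gG i) (gL j).
(* All levels above k map through level k + 1, whose map to level j has finite rank by maximality.
   Subtracting from [h0] a finite rank map [F] that agrees with it there kills them. If k is the
   last index there is nothing to kill. *)
have [h [hh0 hv]] : exists h : {linear level M j -> G i},
    finrank (fun x => h x - h0 x) /\
    forall (t : 'I_n.+1) (x : level M t), (k < t)%N -> h (trans M t j x) = 0.
  have [kn|nk] := ltnP k.+1 n.+1; last first.
    exists h0; split.
      by apply: eq_finrank (finrank0 _ _) => x; rewrite subrr.
    by move=> t x kt; have := leq_trans (ltn_ord t) (leq_trans nk kt); rewrite ltnn.
  pose k' := Ordinal kn.
  have jk' : (j <= k')%N by rewrite ltnW.
  have fk' : finrank (trans M k' j) by apply: frk => //=; rewrite subSn.
  have [F fF FE] := finrank_extend (trans_extend gM jk') (finrank_compl h0 fk').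
  have lh : linear (fun x => h0 x - F x).
    by move=> a x y; rewrite (linearP h0) (linearP F) scalerBr opprD addrACA.
  exists (mklin lh); split.
    apply: eq_finrank (finrankB (finrank0 _ _) fF) => x.
    by rewrite /= addrAC subrr.
  move=> t x kt; rewrite -(trans_trans (j := k')) // -[LHS]/(h0 _ - F _) FE.
  exact: subrr.
(* Since [P i] is projective, this composite has finite rank whatever [h] is, so it extends to level
   0. *)
have fih : finrank (fun x => iota i (h x)).
  exact: (finrank_compr [the {linear level M j -> P i} of iota i \o h] (fg_proj_finrank fpP)).
have [rho _ rhoE] := finrank_extend (trans_extend gM (leq0n j : (ord0 <= j)%N)) fih.
(* Levels below j are reached through level j - 1. By maximality the map from level k to it has
   finite rank, so its composite with [v] extends along [iota i]. For j = 0 the conditions are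
   empty. *)
have [sigma [sigE sigT]] : exists sigma : forall t : 'I_n.+1, {linear P i -> level M t},
    (forall (t : 'I_n.+1) g, (t < j)%N -> sigma t (iota i g) = trans M k t (v g)) /\
    (forall (s t : 'I_n.+1) p, (s <= t)%N -> (t < j)%N -> trans M t s (sigma t p) = sigma s p).
  have [j0|j_gt0] := posnP j.
    by exists (fun t => [the {linear _ -> level M t} of \0]); split=> [t g|s t p _]; rewrite j0.
  have pj : (j.-1 < n.+1)%N by rewrite (leq_ltn_trans (leq_pred j)).
  pose j' := Ordinal pj.
  have jk' : (j' <= k)%N by rewrite (leq_trans (leq_pred j)).
  have tj' (t : 'I_n.+1) : (t < j)%N -> (t <= j')%N by move=> tj; rewrite -ltnS /= prednK.
  have fk' : finrank (trans M k j').
    by apply: frk => //=; rewrite ltn_sub2l // ?prednK // (leq_ltn_trans _ jk) // ?prednK.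
  have [S _ SE] := finrank_extend iext (finrank_compr v fk').
  exists (fun t => [the {linear P i -> level M t} of trans M j' t \o S]); split.
    by move=> t g /tj' tj; rewrite -[LHS]/(trans M j' t (S (iota i g))) SE trans_trans.
  by move=> s t p st /tj' tj; apply: trans_trans.
have [beta [alpha ab]] := interval_factor iI jk hv rhoE sigE sigT.
exists i, k, j; apply: (retract_of_factor (beta := beta) (alpha := alpha)) => // m nil.
(* The restriction of the endomorphism to level k. *)
pose e := [the {linear level M k -> level M k} of v \o h \o trans M k j].
have e0 x : iter m e x = 0.
  by apply: val_inj; rewrite -(level_iter (f := alpha \o beta)) ?nil.
have regh : finrank (fun x => f (h (f x)) - f x).
  have d1 := finrank_compl f (finrank_compr f hh0).
  apply: eq_finrank (finrankD d1 reg) => x.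
  by rewrite (linearB f) addrA subrK.
(* This is f (h f)^m' = f modulo finite rank. If [e] were nilpotent, [f] itself would have finite
   rank, against the choice of [v]. *)
have D m' : finrank (fun x => trans M k j (iter m' e (v x)) - f x).
  elim: m' => [|m' IH]; first by apply: eq_finrank (finrank0 _ _) => x; rewrite subrr.
  have := finrank_compr [the {linear G i -> G i} of h \o f] IH.
  move=> IH'; apply: eq_finrank (finrankD IH' regh) => x.
  rewrite addrA subrK iterSr; congr (_ - _).
apply: nfv; apply: finrankBr (D m) _.
by apply: eq_finrank (finrank0 _ _) => x; rewrite e0 linear0.
Qed.

End Main.

Theorem proposition5p5 (L : pzRingType) (hL : omegaG_algebra L)
    (n : nat) (hn : (1 <= n)%N) :
  cm_finite (trig_ring n L).
Proof.
case: n hn => // n _; have [art _ ss] := hL.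
have [r [G [gG gen]]] := omegaG_generators hL.
have [P HP] := choice (fun i => gorenstein_embedding (gG i)).
pose iota i := sval (cid (HP i)).
have iotaP i := svalP (cid (HP i)).
pose cov := fun (N M : rmodType (trig_ring n.+1 L)) =>
  [/\ finlen M, indecomposable M & retract M N].
have c1 : finite_cover (fun M => exists i k j, cov (interval (iota i) k j) M).
  apply: finite_cover_ex => i; apply: finite_cover_ex => k; apply: finite_cover_ex => j.
  apply: finite_cover_retract; apply: interval_finlen => //.
  by have [_ [] ] := iotaP i.
have c2 : finite_cover (fun M => exists k : 'I_n.+1,
    cov (interval [the {linear regular_rmod L -> regular_rmod L} of idfun] k ord0) M).
  apply: finite_cover_ex => k; apply: finite_cover_retract; apply: interval_finlen => //.
  exists 1%N, (fun=> 1) => x; exists (fun=> x); rewrite big_ord1.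
  exact/esym/mulr1.
have [|m [K H]] := finite_coverU c1 c2
    (R := fun M => gorenstein_projective M /\ indecomposable M); last first.
  by exists m, K => M gM indM; apply: H.
move=> M [gM indM].
have flM : finlen M := filtered_finlen (fg_filtered (trig_filtered n.+1 art) gM.1).
have [fr|nfr] := pselect (forall k : 'I_n.+1, finrank (trans M k k)).
  by right; have [k rk] := projective_levels art gM indM fr; exists k.
left; have [i [k [j rM]]] := nonprojective_levels art ss gG iotaP gen gM indM nfr.
by exists i, k, j.
Qed.
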